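(* Let $\mathbb{K}\subset\mathbb{C}$ be an algebraically closed field and consider the system of linear differential equations $$\dot y=A(t)y,\qquad A\in\operatorname{Mat}_{n\times n}(\mathbb{K}(t)).$$ Let $q(t)\in\mathbb{K}[t]$ be a non-zero polynomial of minimal degree such that $\tilde A(t):=q(t)A(t)$ has polynomial entries and $\tilde A(t)=0$ whenever $t$ is a pole of $A(t)$. Consider the polynomial vector field on $\mathbb{C}_t\times\mathbb{C}^n_y$ $$\xi=q(t)\frac{\partial}{\partial t}+\sum_{i=1}^n\big(\tilde A(t)y\big)_i\frac{\partial}{\partial y_i}.$$ Then $\xi$ has constructible orbits in $\mathbb{C}_t\times\mathbb{C}^n_y$.
   Context: $\mathbb{C}_t\times\mathbb{C}_y^n\simeq\mathbb{C}^{n+1}$ has coordinates $t$ and $y=(y_1,\ldots,y_n)$. For a polynomial vector field $\xi$ on $\mathbb{C}^N$, $\operatorname{Sing}\xi$ is the common zero set of its coefficients. For $p\in\mathbb{C}^N$ the orbit $\mathcal{O}_p$ is the leaf through $p$ of the singular complex holomorphic foliation defined by $\xi$: if $p\in\operatorname{Sing}\xi$ then $\mathcal{O}_p=\{p\}$, and otherwise $\mathcal{O}_p$ is the leaf through $p$ of the foliation of $\mathbb{C}^N\setminus\operatorname{Sing}\xi$ by complex integral curves of $\xi$. $\overline{\mathcal{O}}_p$ denotes the Zariski closure of $\mathcal{O}_p$. If $\xi$ is defined over $\mathbb{K}$ and $V\subset\mathbb{C}^N$ is a $\xi$-invariant variety (a union of orbits) defined over $\mathbb{K}$, then $\xi$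 has constructible orbits in $V$ if the relation $E=\{(p,q)\in V\times V: q\in\overline{\mathcal{O}}_p\}$ is constructible over $\mathbb{K}$. *)

(* Defs.v *)
(* MathComp, with MathComp-Analysis for complex derivatives. *)
From Stdlib Require Import Relation_Operators.
From HB Require Import structures.
From mathcomp Require Import all_boot all_order all_algebra.
(* The notations of mpoly clash with those of MathComp-Analysis. *)
From mathcomp Require Import -(notations) mpoly.
From mathcomp Require Import boolp classical_sets reals topology normedtype derive.
Import GRing.Theory Num.Theory.
Import numFieldNormedType.Exports.

Set Implicit Arguments.
Unset Strict Implicit.
Unset Printing Implicit Defensive.

Local Open Scope ring_scope.
Local Open Scope classical_set_scope.

Definition eval (F : fieldType) (N : nat) (f : mpoly N F) (v : 'rV[F]_N) : F :=
  meval (fun i => v 0 i) f.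

Definition vector_field (F : fieldType) (N : nat) := 'I_N -> mpoly N F.

Definition Sing (C : numClosedFieldType) (N : nat) (xi : vector_field C N) :
  set 'rV[C]_N := [set p | forall i, eval (xi i) p = 0].

(* p and q lie on one plaque of the foliation of the complement of Sing xi: a
   complex integral curve of xi, defined on a disc, passes through both. *)
Definition same_plaque (C : numClosedFieldType) (N : nat)
    (xi : vector_field C N) (p q : 'rV[C]_N) : Prop :=
  exists (c r : C) (phi : C -> 'rV[C]_N),
    (forall z : C, ball c r z -> ~ Sing xi (phi z) /\
       forall i, is_derive (z : C^o) (1 : C^o)
         ((fun w => phi w 0 i) : C^o -> C^o) (eval (xi i) (phi z))) /\
    exists2 z, ball c r z & exists2 w, ball c r w & phi z = p /\ phi w = q.

(* Leaves are the classes of points joined by finite chains of plaques. *)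
Definition orbit (C : numClosedFieldType) (N : nat) (xi : vector_field C N)
  (p : 'rV[C]_N) : set 'rV[C]_N :=
  [set q | (Sing xi p /\ q = p) \/
           (~ Sing xi p /\ clos_refl_trans _ (same_plaque xi) p q)].

Definition zariski_closure (C : fieldType) (N : nat) (S : set 'rV[C]_N) :
  set 'rV[C]_N :=
  [set q | forall f : mpoly N C,
     (forall p, S p -> eval f p = 0) -> eval f q = 0].

Definition zero_set (K C : fieldType) (iota : {rmorphism K -> C}) (N : nat)
  (fs : seq (mpoly N K)) : set 'rV[C]_N :=
  [set p | forall f, f \in fs -> eval (map_mpoly iota f) p = 0].

(* Finite unions of differences of closed sets defined over K. *)
Definition constructible_over (K C : fieldType) (iota : {rmorphism K -> C})
  (N : nat) (S : set 'rV[C]_N) : Prop :=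
  exists pieces : seq (seq (mpoly N K) * seq (mpoly N K)),
    S = [set p | exists2 FG, FG \in pieces &
           zero_set iota FG.1 p /\ ~ zero_set iota FG.2 p].

(* A pair (p, q) is encoded as the point [row_mx p q] of affine 2N-space. *)
Definition constructible_orbits (K : fieldType) (C : numClosedFieldType)
    (iota : {rmorphism K -> C}) (N : nat) (xi : vector_field K N)
    (V : set 'rV[C]_N) : Prop :=
  let xiC := fun i => map_mpoly iota (xi i) in
  constructible_over iota
    [set pq : 'rV[C]_(N + N) |
       [/\ V (lsubmx pq), V (rsubmx pq) &
           zariski_closure (orbit xiC (lsubmx pq)) (rsubmx pq)]].

Definition regular_at (K C : fieldType) (iota : {rmorphism K -> C})
  (f : {fraction {poly K}}) (t : C) : Prop :=
  exists a b : {poly K},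
    f = tofrac a / tofrac b /\ (map_poly iota b).[t] != 0.

Definition pole (K C : fieldType) (iota : {rmorphism K -> C}) (n : nat)
  (A : 'M[{fraction {poly K}}]_n) (t : C) : Prop :=
  exists i j, ~ regular_at iota (A i j) t.

Definition clears_poles (K C : fieldType) (iota : {rmorphism K -> C}) (n : nat)
    (A : 'M[{fraction {poly K}}]_n) (q : {poly K}) (At : 'M[{poly K}]_n) :
  Prop :=
  [/\ q != 0,
      forall i j, tofrac (At i j) = tofrac q * A i j &
      forall t : C, pole iota A t -> forall i j, (map_poly iota (At i j)).[t] = 0].

(* On affine (1 + n)-space, variable [lshift n 0] is t and variable
   [rshift 1 j] is y_j. *)
Definition coord (K : fieldType) (N : nat) (i : 'I_N) : mpoly N K :=
  mpolyX K (mnm1 i).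

Definition in_t (K : fieldType) (n : nat) (p : {poly K}) : mpoly (1 + n) K :=
  (map_poly (@mpolyC (1 + n) K) p).[coord K (lshift n 0)].

Definition system_vf (K : fieldType) (n : nat) (q : {poly K})
    (At : 'M[{poly K}]_n) : vector_field K (1 + n) :=
  fun i => match split i with
  | inl _ => in_t n q
  | inr j => \sum_(k < n) in_t n (At j k) * coord K (rshift 1 k)
  end.

(* Main.v *)
Require Import Defs.
From Stdlib Require Import Relation_Operators.
From HB Require Import structures.
From mathcomp Require Import all_boot all_order all_algebra.
From mathcomp Require Import complex.
From mathcomp Require Import -(notations) mpoly.
From mathcomp Require Import boolp classical_sets functions reals topology normedtype derive.
From mathcomp Require Import sequences realfun exp.
From mathcomp Require Import ring.
Import Order.TTheory GRing.Theory Num.Theory.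
Import numFieldNormedType.Exports.
Set Implicit Arguments.
Unset Strict Implicit.
Unset Printing Implicit Defensive.
Local Open Scope ring_scope.
Local Open Scope classical_set_scope.
Local Open Scope complex_scope.

(* Call a polynomial flat at x when it vanishes at x with all its iterated Lie
   derivatives. By existence (Lie series) and uniqueness (Gronwall) of integral
   curves, the flat polynomials at a regular point form the ideal of its orbit.
   Append to (t, y) a matrix of unknowns g with g' = A g, started at the identity
   over p. The flat polynomials of bounded degree at this starting point are the
   kernel of a matrix depending polynomially on p, and its rank is constant where
   q <> 0: the flow moves t through infinitely many values, and the symmetries
   (y, g) |-> (y + g v, g h) absorb the rest of the starting point. By Cramer's
   rule the flat polynomials at every p are then spanned by the specialisations at
   p of polynomial families defined over K. Groebner elimination of g with
   parameters turns these families into finitely many equations over K for the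
   orbit closures, over a nonempty open part of each irreducible closed set of
   points p, and Noetherian induction on p concludes. Where q = 0 the field
   vanishes and orbits are points. *)

(** The obstacle is uniformity in p. In the coordinates (t, y) alone the space of flat polynomials
    of bounded degree changes dimension with p: for y' = y it is larger at y = 0 than elsewhere.
    Specialising a generic basis then misses equations at special points. The frame cures this: over
    a fixed t, the affine substitutions by v and h carry any point with invertible frame to the
    start over any y, so only t can influence the rank, and the flow links different values of t.
    The price is that orbit ideals in (t, y) must be recovered as the g-free part of the extended
    ideals, and elimination does not commute with specialisation. It does so where the leading
    coefficients of a generic Groebner basis stay invertible, which is why equations are found only
    on an open part of each irreducible closed set. The condition on the poles of A enters through
    [Sing]: it makes the singular set exactly q(t) = 0, so that q <> 0 is the right notion of
    regular point. *)

Local Notation eval := Defs.eval.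
Local Notation orbit := Defs.orbit.
Local Notation normc := ComplexField.Normc.normc.
Local Notation "p @_ m" := (mcoeff m p) (at level 3, left associativity, m at level 2) : ring_scope.
Local Notation mdvd a b := (forall i, (a i <= b i)%N).

(** * Ideals of polynomials *)

Lemma mpoly_rmorph_ext n (R S : comNzRingType) (f g : {rmorphism mpoly n R -> S}) :
  (forall c, f (mpolyC n c) = g (mpolyC n c)) ->
  (forall i, f (mpolyX R (mnm1 i)) = g (mpolyX R (mnm1 i))) -> f =1 g.
Proof.
move=> fgC fgX p; elim/mpolyind: p => [|c m p _ _ IH]; first by rewrite !rmorph0.
rewrite !rmorphD IH -mul_mpolyC !rmorphM fgC; congr (_ * _ + _).
rewrite mpolyXE_id !rmorph_prod; apply: eq_bigr => i _.
by rewrite !rmorphXn /= fgX.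
Qed.

Lemma meval_map n (R S : comNzRingType) (f : {rmorphism R -> S}) (x : 'I_n -> S) p :
  meval x (map_mpoly f p) = mmap f x p.
Proof.
apply: (mpoly_rmorph_ext (f := meval x \o map_mpoly f) (g := mmap f x)) => [c|i] /=.
  by rewrite map_mpolyC mevalC mmapC.
by rewrite map_mpolyX mevalXU mmapX mmap1U.
Qed.

(** Induction on the number of coordinates in which members of L may differ. Given a member m0,
    another member either dominates m0 or is smaller than it in some coordinate i; the latter lie in
    the finitely many slices with i-th exponent j < m0 i, which vary in one coordinate less. *)
Lemma dickson n (L : multinom n -> Prop) :
  exists s : seq (multinom n), (forall m, m \in s -> L m) /\
    forall m, L m -> exists2 b, b \in s & mdvd b m.
Proof.
suff H k : forall (A : {set 'I_n}) (L : multinom n -> Prop), #|A| = k ->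
    (forall m m', L m -> L m' -> forall i, i \notin A -> m i = m' i) ->
    exists s : seq (multinom n), (forall m, m \in s -> L m) /\
    forall m, L m -> exists2 b, b \in s & mdvd b m.
  by apply: (H _ (finset.setTfor 'I_n) L erefl) => m m' _ _ i; rewrite inE.
elim: k => [|k IH] A {}L cA agree;
  (have [[m0 Lm0]|L0] := pselect (exists m0, L m0);
    last by exists [::]; split=> // m Lm; case: L0; exists m).
  exists [:: m0]; split=> [m|m Lm]; first by rewrite inE => /eqP ->.
  exists m0; first by rewrite inE.
  by move=> i; rewrite (agree m m0) // (cards0_eq cA) inE.
pose Lij (i : 'I_n) (j : nat) (m : multinom n) := L m /\ m i = j.
have /choice[t tP] (i : 'I_n) : exists t : nat -> seq (multinom n), i \in A ->
    forall j, (forall m, m \in t j -> Lij i j m) /\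
    forall m, Lij i j m -> exists2 b, b \in t j & mdvd b m.
  have [iA|] := boolP (i \in A); last by exists (fun=> [::]).
  suff /choice[t tP] : forall j, exists t : seq (multinom n),
    (forall m, m \in t -> Lij i j m) /\
    forall m, Lij i j m -> exists2 b, b \in t & mdvd b m by exists t.
  move=> j; apply: (IH (A :\ i)) => [|m m' [Lm mi] [Lm' mi'] i'].
    by move: cA; rewrite (cardsD1 i) iA => -[].
  rewrite in_setD1 negb_and negbK => /orP[/eqP ->|]; first by rewrite mi mi'.
  exact: agree.
exists (m0 :: flatten [seq flatten [seq t i j | j <- iota 0 (m0 i)] | i <- enum A]).
split=> [m|m Lm].
  rewrite inE => /orP[/eqP ->//|].
  case/(flatten_mapP (A := fun i => flatten [seq t i j | j <- iota 0 (m0 i)])) => i.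
  rewrite mem_enum => iA /flatten_mapP[j _ mt].
  by have [/(_ _ mt)[]] := tP i iA j.
have [/forallP le_m0m|/forallPn[i1]] := boolP [forall i, (m0 i <= m i)%N].
  by exists m0 => //; rewrite inE eqxx.
rewrite -ltnNge; move: i1 => i lt_i.
have iA : i \in A.
  by apply/negPn/negP => /(agree m m0 Lm Lm0) e; rewrite e ltnn in lt_i.
have [_ /(_ m (conj Lm erefl))[b bt le_bm]] := tP i iA (m i).
exists b => //; rewrite inE; apply/orP; right.
apply/flatten_mapP; exists i; first by rewrite mem_enum.
by apply/flatten_mapP; exists (m i) => //; rewrite mem_iota.
Qed.

Definition is_ideal (A : comNzRingType) (J : set A) : Prop :=
  [/\ J 0, (forall a b, J a -> J b -> J (a + b)) & forall a b, J b -> J (a * b)].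

Definition ideal_of (A : comNzRingType) (s : seq A) : set A :=
  [set a | exists c : nat -> A, a = \sum_(i < size s) c i * s`_i].

Lemma ideal_ofP (A : comNzRingType) (s : seq A) : is_ideal (ideal_of s).
Proof.
split=> [|a b [c ->] [d ->]|a b [c ->]].
- by exists (fun=> 0); rewrite big1 // => g _; rewrite mul0r.
- exists (fun i => c i + d i); rewrite -big_split; apply: eq_bigr => i _ /=.
  by rewrite mulrDl.
- by exists (fun i => a * c i); rewrite mulr_sumr; apply: eq_bigr => g _; rewrite mulrA.
Qed.

Lemma is_ideal_sum (A : comNzRingType) (J : set A) I (r : seq I) (P : pred I) F :
  is_ideal J -> (forall i, P i -> J (F i)) -> J (\sum_(i <- r | P i) F i).
Proof. by move=> [J0 JD _] JF; apply: big_ind. Qed.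

Lemma is_idealB (A : comNzRingType) (J : set A) a b :
  is_ideal J -> J a -> J b -> J (a - b).
Proof. by move=> [_ JD JM] Ja Jb; apply: JD => //; rewrite -mulN1r; apply: JM. Qed.

Lemma ideal_of_sub (A : comNzRingType) (s : seq A) (J : set A) :
  is_ideal J -> (forall g, g \in s -> J g) -> ideal_of s `<=` J.
Proof.
move=> idJ sJ a [c ->]; apply: is_ideal_sum => // i _.
by case: idJ => _ _; apply; apply: sJ; apply: mem_nth.
Qed.

Lemma mem_ideal_of (A : comNzRingType) (s : seq A) g : g \in s -> ideal_of s g.
Proof.
move=> gs; have lt_g : (index g s < size s)%N by rewrite index_mem.
exists (fun i => (i == index g s)%:R); rewrite (bigD1 (Ordinal lt_g)) //= eqxx mul1r.
rewrite nth_index // big1 ?addr0 // => i /negPf.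
by rewrite -val_eqE /= => ->; rewrite mul0r.
Qed.

(** Dickson's lemma, applied to the leading monomials of J, selects the generators; subtracting
    monomial multiples of them lowers the leading monomial, and the monomial order is well
    founded. *)
Lemma hilbert_basis (F : fieldType) n (J : set (mpoly n F)) : is_ideal J ->
  exists s, J = ideal_of s.
Proof.
move=> idJ; have [s [sL Ls]] := dickson (fun m => exists f, [/\ J f, f != 0 & mlead f = m]).
have /choice[h hP] m : exists f, m \in s -> [/\ J f, f != 0 & mlead f = m].
  by have [/sL[f]|_] := boolP (m \in s); [exists f | exists 0].
exists (map h s); apply/seteqP; split; last first.
  by apply: ideal_of_sub => // _ /mapP[m ms ->]; have [] := hP m ms.
have [J0 JD JM] := ideal_ofP (map h s).
move=> f; elim/(@mleadrect n F): f => f IH Jf.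
have [->|f0] := eqVneq f 0; first exact: J0.
have [b bs le_b] : exists2 b, b \in s & mdvd b (mlead f).
  by apply: Ls; exists f.
have [Jh h0 hb] := hP b bs.
pose d := mnm_sub (mlead f) b.
have dE : mnm_add d b = mlead f by apply/mnmP => i; rewrite !mnmE subnK.
pose c := f@_(mlead f) / (h b)@_b.
have hb0 : (h b)@_b != 0 by rewrite -[X in _@_X]hb mleadc_eq0.
pose g := c *: (mpolyX F d * h b).
have Ig : ideal_of (map h s) g.
  by rewrite /g -mul_mpolyC mulrA; apply: JM; apply: mem_ideal_of; apply: map_f.
rewrite -(subrK g f); apply: (JD _ _ _ Ig).
have [->|fg0] := eqVneq (f - g) 0; first exact: J0.
have Jg : J g by rewrite /g -mul_mpolyC mulrA; case: idJ => _ _; apply.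
apply: IH; last exact: is_idealB.
have glead : mlead (mpolyX F d * h b) = mlead f.
  by rewrite mleadM ?mpolyX_eq0 ?mleadXm ?hb // -?msize_poly_eq0 ?msizeX.
have gle : (mlead g <= mlead f)%O by rewrite -glead; apply: mleadZ_le.
have : (mlead (f - g) <= mlead f)%O.
  by apply: le_trans (mleadB_le _ _) _; rewrite leUx lexx.
rewrite le_eqVlt => /orP[/eqP e|//].
have /negP[] := fg0; rewrite -mleadc_eq0 e mcoeffB mcoeffZ.
have -> : (mpolyX F d * h b)@_(mlead f) = (h b)@_b by rewrite -dE mulrC mcoeffMX.
by rewrite divfK // subrr.
Qed.

(** A counterexample would start, by choice, a strictly increasing chain of ideals; the generators
    of its union all lie in one term, where the chain must stop. *)
Lemma noetherian_induction (F : fieldType) n (P : set (mpoly n F) -> Prop) :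
  (forall J, is_ideal J ->
     (forall J', is_ideal J' -> J `<=` J' -> (exists2 a, J' a & ~ J a) -> P J') -> P J) ->
  forall J, is_ideal J -> P J.
Proof.
move=> step J0 idJ0; apply: contrapT => nP0.
pose T := {J : set (mpoly n F) | is_ideal J /\ ~ P J}.
have /choice[nxt nxtP] (J : T) : exists J' : T, sval J `<=` sval J' /\
    exists2 a, sval J' a & ~ sval J a.
  case: J => J [idJ nPJ] /=; apply: contrapT => nex; apply: nPJ; apply: step => // J' idJ' sub a.
  by apply: contrapT => nPJ'; apply: nex; exists (exist _ J' (conj idJ' nPJ')).
pose t k := sval (iter k nxt (exist _ J0 (conj idJ0 nP0) : T)).
have tid k : is_ideal (t k) by rewrite /t; case: (iter _ _ _) => ? [].
have tS k l : (k <= l)%N -> t k `<=` t l.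
  move=> /subnK <-; elim: (l - k)%N => // d IH a /IH; exact: (nxtP _).1.
pose U := [set a | exists k, t k a].
have idU : is_ideal U.
  split=> [|a b [k ka] [l lb]|a b [k kb]].
  - by exists 0%N; have [] := tid 0%N.
  - exists (maxn k l); have [_ + _] := tid (maxn k l); apply.
    + exact: tS (leq_maxl _ _) _ ka.
    + exact: tS (leq_maxr _ _) _ lb.
  - by exists k; have [_ _] := tid k; apply.
have [s Us] := hilbert_basis idU.
have [k sk] : exists k, forall g, g \in s -> t k g.
  have: forall g, g \in s -> U g by move=> g gs; rewrite Us; apply: mem_ideal_of.
  elim: s {Us} => [_|g s IH sU]; first by exists 0%N.
  have [k kP] := IH (fun h hs => sU h (mem_behead (s := g :: s) hs)).
  have [l lg] := sU g (mem_head _ _); exists (maxn k l) => h.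
  rewrite inE => /predU1P[->|/kP]; last exact: tS (leq_maxl _ _) _.
  exact: tS (leq_maxr _ _) _ lg.
have [_ [a ta nta]] := nxtP (iter k nxt (exist _ J0 (conj idJ0 nP0) : T)).
apply: nta; apply: (ideal_of_sub (tid k) sk); rewrite -Us.
by exists k.+1.
Qed.

(** Applied to iterated Lie derivatives, this turns infinitely many vanishing conditions into a
    finite linear differential system. *)
Lemma ideal_chain (F : fieldType) n (f : nat -> mpoly n F) :
  exists m (c : nat -> mpoly n F), f m = \sum_(k < m) c k * f k.
Proof.
pose U := [set a | exists m, ideal_of (mkseq f m) a].
have mono k l : (k <= l)%N -> ideal_of (mkseq f k) `<=` ideal_of (mkseq f l).
  move=> le_kl; apply: ideal_of_sub; first exact: ideal_ofP.
  move=> g /mapP[j]; rewrite mem_iota /= => lt_ik ->; apply/mem_ideal_of/map_f.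
  by rewrite mem_iota (leq_trans lt_ik).
have idU : is_ideal U.
  split=> [|a b [k ka] [l lb]|a b [k kb]].
  - by exists 0%N; have [] := ideal_ofP (mkseq f 0%N).
  - exists (maxn k l); have [_ + _] := ideal_ofP (mkseq f (maxn k l)); apply.
    + exact: mono (leq_maxl _ _) _ ka.
    + exact: mono (leq_maxr _ _) _ lb.
  - by exists k; have [_ _] := ideal_ofP (mkseq f k); apply.
have [s Us] := hilbert_basis idU.
have [k sk] : exists k, forall g, g \in s -> ideal_of (mkseq f k) g.
  have: forall g, g \in s -> U g by move=> g gs; rewrite Us; apply: mem_ideal_of.
  elim: s {Us} => [_|g s IH sU]; first by exists 0%N.
  have [k kP] := IH (fun h hs => sU h (mem_behead (s := g :: s) hs)).
  have [l lg] := sU g (mem_head _ _); exists (maxn k l) => h.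
  rewrite inE => /predU1P[->|/kP]; last exact: mono (leq_maxl _ _) _.
  exact: mono (leq_maxr _ _) _ lg.
have [c cE] : ideal_of (mkseq f k) (f k).
  apply: (ideal_of_sub (ideal_ofP _) sk); rewrite -Us.
  by exists k.+1; apply/mem_ideal_of/map_f; rewrite mem_iota /=.
exists k, c; rewrite cE size_mkseq; apply: eq_bigr => i _.
by rewrite nth_mkseq.
Qed.

(** * Elimination with parameters *)

Section Elimination.
Context (A0 : comNzRingType) (M : nat) (W : pred 'I_M).

Definition wdeg (m : multinom M) : nat := \sum_(i | W i) m i.

Lemma wdegD a b : wdeg (mnm_add a b) = (wdeg a + wdeg b)%N.
Proof. by rewrite /wdeg -big_split; apply: eq_bigr => i _; rewrite mnmDE. Qed.

(** An elimination order for the variables in W: a polynomial whose leading monomial avoids W avoids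
    W altogether. *)
Definition elim_lt (a b : multinom M) : bool :=
  (wdeg a < wdeg b)%N || (wdeg a == wdeg b) && (a < b)%O.

Lemma elim_lt_wf : well_founded elim_lt.
Proof.
suff H k : forall m, wdeg m = k -> Acc elim_lt m by move=> m; exact: (H _ m erefl).
elim/ltn_ind: k => k IH; elim/(well_founded_ind (@ltom_wf M)) => m IHm wm.
constructor=> a /orP[lt_a|/andP[/eqP wa lt_a]]; last by apply: IHm; rewrite ?wa.
by apply: (IH (wdeg a)) => //; rewrite -wm.
Qed.

Lemma elim_lt_total a b : a != b -> elim_lt a b || elim_lt b a.
Proof.
rewrite /elim_lt; case: (ltngtP (wdeg a) (wdeg b)) => //= _.
by case: (ltgtP a b).
Qed.

Lemma elim_lt_trans : transitive elim_lt.
Proof.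
move=> b a c /orP[ab|/andP[/eqP ab ab']] /orP[bc|/andP[/eqP bc bc']]; apply/orP.
- by left; apply: ltn_trans bc.
- by left; rewrite -bc.
- by left; rewrite ab.
- by right; rewrite ab bc eqxx (lt_trans ab').
Qed.

Lemma elim_ltD c a b : elim_lt a b -> elim_lt (mnm_add c a) (mnm_add c b).
Proof. by rewrite /elim_lt !wdegD ltn_add2l eqn_add2l ltmc_add2r. Qed.

Lemma elim_max (s : seq (multinom M)) : s != [::] ->
  exists2 v, v \in s & forall k, k \in s -> (k == v) || elim_lt k v.
Proof.
elim: s => // a [|b s] IH _.
  by exists a; rewrite ?inE // => k; rewrite inE => ->.
have [//|v vs vmax] := IH; have [->|ne] := eqVneq a v.
  exists v; first by rewrite inE eqxx.
  by move=> k; rewrite inE => /predU1P[->|/vmax//]; rewrite eqxx.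
have [lt|/negPf lt] := boolP (elim_lt a v).
  exists v; first by rewrite inE vs orbT.
  by move=> k; rewrite inE => /predU1P[->|/vmax//]; rewrite lt orbT.
have lt' : elim_lt v a by have := elim_lt_total ne; rewrite lt.
exists a; first by rewrite inE eqxx.
move=> k; rewrite inE => /predU1P[->|/vmax/predU1P[->|kv]]; first by rewrite eqxx.
  by rewrite lt' orbT.
by rewrite (elim_lt_trans kv lt') orbT.
Qed.

Lemma mcoeffXM (R : comNzRingType) (G : mpoly M R) d k :
  (mpolyX R d * G)@_(mnm_add d k) = G@_k.
Proof. by rewrite mulrC mcoeffMX. Qed.

Lemma mcoeffXM_neq0 (R : comNzRingType) (G : mpoly M R) d k :
  (mpolyX R d * G)@_k != 0 -> exists2 k', k = mnm_add d k' & G@_k' != 0.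
Proof.
rewrite mulrC -mcoeff_msupp (perm_mem (msuppMX _ _)) => /mapP[k' k's ->].
by exists k' => //; rewrite -mcoeff_msupp.
Qed.

Variables (J : set A0) (I : set (mpoly M A0)).
Hypotheses (idJ : is_ideal J) (J1 : ~ J 1) (Jprime : forall a b, J (a * b) -> J a \/ J b).
Hypotheses (ID : forall F G, I F -> I G -> I (F + G)) (IZ : forall a F, I F -> I (a *: F)).
Hypothesis (IX : forall m F, I F -> I (mpolyX A0 m * F)).

(** Coefficients in J count as zero, since only parameters where J vanishes are considered. Thus
    [leads F v] makes v the leading monomial of F over the quotient by J. *)
Definition bounded (F : mpoly M A0) v :=
  forall k, ~ J F@_k -> (k == v) || elim_lt k v.

Definition leads (F : mpoly M A0) v := [/\ I F, ~ J F@_v & bounded F v].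

(* Groebner bases with parameters: off the zeros of the leading coefficients, the
   leading monomials of the specialised ideal are the generic ones. *)
Lemma parametric_elimination : exists2 a, ~ J a & exists2 Gs : seq (mpoly M A0),
  (forall G, G \in Gs -> I G /\ forall m, wdeg m != 0%N -> J G@_m) &
  forall (C : fieldType) (ev : {rmorphism A0 -> C}) (x : 'I_M -> C),
  (forall b, J b -> ev b = 0) -> ev a != 0 ->
  (forall G, G \in Gs -> mmap ev x G = 0) ->
  forall l (c : 'I_l -> C) (F : 'I_l -> mpoly M A0), (forall i, I (F i)) ->
  let f := \sum_i c i *: map_mpoly ev (F i) in
  (forall m, wdeg m != 0%N -> f@_m = 0) -> meval x f = 0.
Proof.
have [s [sL Ls]] := dickson (fun m => exists F, leads F m).
have /choice[G GP] m : exists F, m \in s -> leads F m.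
  by have [/sL[F]|_] := boolP (m \in s); [exists F | exists 0].
have J0 : J 0 by case: idJ.
(* As J is prime, the product of the leading coefficients stays outside J; where it does not vanish,
   each of them specialises to a unit. *)
exists (\prod_(b <- s) (G b)@_b).
  rewrite big_seq; apply: (big_ind (fun a => ~ J a)) => // [a b na nb /Jprime[]//|b bs].
  by have [] := GP b bs.
have ledeg k v : (k == v) || elim_lt k v -> (wdeg k <= wdeg v)%N.
  by case/orP=> [/eqP ->//|/orP[/ltnW//|/andP[/eqP ->]]].
exists [seq G b | b <- s & wdeg b == 0%N].
  move=> _ /mapP[b + ->]; rewrite mem_filter => /andP[/eqP b0 bs].
  have [IG nJ bd] := GP b bs; split=> // m m0; apply: contrapT => /bd/ledeg.
  by rewrite b0 leqNgt lt0n m0.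
move=> C ev x evJ eva Gs0.
have evG b : b \in s -> ev (G b)@_b != 0.
  move=> bs; move: eva; rewrite rmorph_prod.
  by rewrite (perm_big _ (perm_to_rem bs)) big_cons mulf_eq0 negb_or => /andP[].
(* The induction runs on a common bound for the monomials of the [F i], not on the leading monomial
   of f, because leading terms may cancel in the combination. *)
pose Q (P : multinom M -> Prop) := forall l (c : 'I_l -> C) (F : 'I_l -> mpoly M A0),
  (forall i, I (F i)) -> (forall i k, ~ J (F i)@_k -> P k) ->
  let f := \sum_i c i *: map_mpoly ev (F i) in
  (forall m, wdeg m != 0%N -> f@_m = 0) -> meval x f = 0.
have low P : (forall v, P v -> Q (fun k => (k == v) || elim_lt k v)) -> Q P.
  move=> PQ l c F IF bF f f0.
  pose S := flatten [seq [seq k <- msupp (F i) | `[< ~ J (F i)@_k >]] | i <- enum 'I_l].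
  have SP k : k \in S <-> exists i, ~ J (F i)@_k.
    split=> [/flatten_mapP[j _]|[j nJ]].
      by rewrite mem_filter => /andP[/asboolP nJ _]; exists j.
    apply/flatten_mapP; exists j; first by rewrite mem_enum.
    rewrite mem_filter; apply/andP; split; first exact/asboolP.
    by rewrite mcoeff_msupp; apply: contra_notN nJ => /eqP ->.
  have [S0|/elim_max[v vS vmax]] := eqVneq S [::].
    rewrite /f big1 ?meval0 // => i _; apply/mpolyP => k.
    rewrite mcoeffZ mcoeff_map_mpoly mcoeff0; apply/eqP; rewrite mulf_eq0.
    apply/orP; right; apply/eqP; apply: evJ; apply: contrapT => nJ.
    by have : k \in S; [apply/SP; exists i | rewrite S0].
  apply: (PQ v) f0 => //; first by have /SP[j /bF] := vS.
  by move=> i k nJ; apply: vmax; apply/SP; exists i.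
have key v : Q (fun k => (k == v) || elim_lt k v).
  elim/(well_founded_ind elim_lt_wf): v => v IH l c F IF bF f f0.
  have fE : f = \sum_i c i *: map_mpoly ev (F i) by [].
  have {IH} := low _ IH; rewrite /Q => {}low.
  have [Lv|nLv] := pselect (exists F, leads F v); last first.
    apply: low f0 => // i k nJ; have [e|->//] := orP (bF i k nJ).
    by case: nLv; exists (F i); split=> //; [rewrite -(eqP e) | exact: bF].
  have [b bs le_b] := Ls v Lv; have [IG nJG bG] := GP b bs.
  pose d := mnm_sub v b.
  have dE : mnm_add d b = v by apply/mnmP => i; rewrite !mnmE subnK.
  pose T := mpolyX A0 d * G b.
  have Tv : T@_v = (G b)@_b by rewrite /T -dE mcoeffXM.
  have bT : bounded T v.
    move=> k nJ; have [|k' kE _] := @mcoeffXM_neq0 _ (G b) d k.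
      by apply: contra_notN nJ => /eqP; rewrite -/T => ->.
    move: nJ; rewrite kE mcoeffXM => /bG; rewrite -dE => /orP[/eqP ->|lt].
      by rewrite eqxx.
    by rewrite (elim_ltD d lt) orbT.
  have IT : I T by exact: IX.
  have tn0 : ev T@_v != 0 by rewrite Tv evG.
  (* Cross-multiplication cancels the coefficient at v within A0; only the specialised coefficient
     [ev T@_v] is ever inverted. *)
  pose F' i := T@_v *: F i + (- (F i)@_v) *: T.
  pose f' := \sum_i (c i / ev T@_v) *: map_mpoly ev (F' i).
  have ff' : f = f' + (f@_v / ev T@_v) *: map_mpoly ev T.
    have -> : f@_v = \sum_i c i * ev (F i)@_v.
      rewrite fE raddf_sum; apply: eq_bigr => i _ /=.
      by rewrite mcoeffZ mcoeff_map_mpoly.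
    rewrite mulr_suml scaler_suml /f' -big_split fE; apply: eq_bigr => i _ /=.
    rewrite /F' rmorphD /= !map_mpolyZ rmorphN scalerDr !scalerA divfK //.
    by rewrite mulrN scaleNr mulrAC subrK.
  have d0 : wdeg v != 0%N -> f@_v = 0 by move=> /f0.
  have f'v : meval x f' = 0.
    apply: low => [i|i k nJ|m m0].
    - by apply: ID; apply: IZ.
    - case: (boolP (k == v)) => [/eqP kv|nkv].
        case: nJ; rewrite kv /F' mcoeffD !mcoeffZ mulNr mulrC subrr.
        by case: idJ.
      have : (k == v) || elim_lt k v.
        have [nJF|JF] := pselect (~ J (F i)@_k); first exact: (bF i k nJF).
        apply: bT => JT; apply: nJ; have [_ JD JM] := idJ.
        rewrite /F' mcoeffD !mcoeffZ; apply: (JD _ _ (JM _ _ _) (JM _ _ JT)).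
        exact: contrapT.
      by rewrite (negPf nkv).
    (* Removing the multiple of T creates no monomial involving W: either its factor [f@_v] is zero,
       or v avoids W and then, modulo J, so does T. *)
    - have -> : f'@_m = f@_m - (f@_v / ev T@_v) * ev T@_m.
        have := congr1 (mcoeff m) ff'; rewrite mcoeffD mcoeffZ mcoeff_map_mpoly => ->.
        by rewrite addrK.
      rewrite f0 // sub0r; have [v0|/d0 ->] := eqVneq (wdeg v) 0%N; last by rewrite !mul0r oppr0.
      rewrite (evJ T@_m) ?mulr0 ?oppr0 //; apply: contrapT => nJ; have := ledeg _ _ (bT _ nJ).
      by rewrite v0 leqNgt lt0n m0.
  rewrite ff' mevalD f'v add0r mevalZ.
  have [v0|/d0 ->] := eqVneq (wdeg v) 0%N; last by rewrite !mul0r.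
  have -> : map_mpoly ev T = mpolyX C d * map_mpoly ev (G b).
    by rewrite /T rmorphM /= map_mpolyX.
  rewrite mevalM meval_map.
  rewrite Gs0 ?mulr0 //; apply/map_f; rewrite mem_filter bs andbT.
  by move: v0; rewrite -dE wdegD => /eqP; rewrite addn_eq0 => /andP[].
by move=> l c F IF f f0; apply: (low (fun=> True)) f0.
Qed.
End Elimination.

(** * Complex calculus *)

(** The form without division admits h = 0 and serves for real and complex derivatives alike. *)
Lemma is_derive_eps (K : numFieldType) (u : K -> K) (z d : K) :
  is_derive (z : K^o) (1 : K^o) (u : K^o -> K^o) d <->
  forall e : K, 0 < e -> exists2 r : K, 0 < r &
    forall h, `|h| < r -> `|u (z + h) - u z - h * d| <= e * `|h|.
Proof.
split=> [[du <-] e e0|H].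
  have /cvgrPdist_le/(_ _ e0) := du.
  move=> /nbhs_ballP[r /= r0 rP]; exists r => // h hr.
  have [->|h0] := eqVneq h 0.
    by rewrite addr0 subrr mul0r subrr !normr0 mulr0.
  have := rP h; rewrite /ball /= sub0r normrN => /(_ hr h0).
  rewrite -/('D_1 (u : K^o -> K^o) (z : K^o)) => le_e.
  have hn0 : 0 < `|h| by rewrite normr_gt0.
  rewrite -ler_pdivrMr //; apply: le_trans le_e.
  rewrite -normfV -normrM distrC le_eqVlt; apply/orP; left; apply/eqP; congr (`|_|).
  rewrite -[_ *: (1 : K^o)]/(h * 1) mulr1 -[_ *: _]/(h^-1 * (u (h + z) - u z)).
  rewrite mulrBl mulrAC divff // mul1r. by rewrite mulrC [h + z]addrC.
have cv : (fun h : K^o => h^-1 *: (((u : K^o -> K^o) \o shift (z : K^o)) (h *: (1 : K^o)) - u z)) @ 0^' --> (d : K^o).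
  apply/cvgrPdist_le => eps eps0; have [r r0 rP] := H eps eps0.
  apply/nbhs_ballP; exists r => //= h.
  rewrite /ball /= sub0r normrN => hr h0.
  have hn0 : 0 < `|h| by rewrite normr_gt0.
  rewrite -(ler_pM2r hn0); apply: le_trans (rP h hr).
  have E : (d - h^-1 *: (u (h *: (1 : K^o) + z) - u z)) * h = - (u (z + h) - u z - h * d).
    have hA : h *: (1 : K^o) = h := mulr1 h.
    have hS (x : K) : h^-1 *: (x : K^o) = h^-1 * x by [].
    by rewrite hA hS mulrBl mulrAC mulVf // mul1r [in RHS]opprB [d * h]mulrC [z + h]addrC.
  by rewrite -normrM E normrN.
by split; [exact: cvgP cv | exact: cvg_lim cv].
Qed.

Lemma pos_common_lower (K : numFieldType) (a b : K) : 0 < a -> 0 < b ->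
  exists2 c, 0 < c & (c <= a) && (c <= b).
Proof.
move=> a0 b0; have [ab|ba] := real_leP (gtr0_real a0) (gtr0_real b0).
  by exists a; rewrite // lexx.
by exists b; rewrite // lexx ltW.
Qed.

Lemma is_derive_near0 (K : numFieldType) (u : K -> K) (z d : K) :
  is_derive (z : K^o) (1 : K^o) (u : K^o -> K^o) d ->
  (exists2 r : K, 0 < r & forall h, `|h| < r -> u (z + h) = 0) -> d = 0.
Proof.
move=> /is_derive_eps H [r r0 u0]; apply/eqP; apply: contraT => d0.
have nd0 : 0 < `|d| by rewrite normr_gt0.
have [r' r'0 r'P] := H (`|d| / 2) (divr_gt0 nd0 (ltr0Sn _ 1)).
have [c c0 /andP[cr cr']] := pos_common_lower r0 r'0.
have h0 : 0 < c / 2 by rewrite divr_gt0.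
have hc : `|c / 2| < c.
  by rewrite gtr0_norm // ltr_pdivrMr // mulr_natr mulr2n ltrDl.
have uz : u z = 0 by rewrite -(addr0 z) u0 ?normr0.
have := r'P (c / 2) (lt_le_trans hc cr').
rewrite (u0 _ (lt_le_trans hc cr)) uz subrr sub0r normrN normrM [_ * `|d|]mulrC.
rewrite ler_pM2r ?normr_gt0 ?gt_eqF // ler_pdivlMr // mulr_natr mulr2n gerDl.
by rewrite lt_geF.
Qed.

Lemma is_derive_near_neq0 (K : numFieldType) (u : K -> K) (z d : K) :
  is_derive (z : K^o) (1 : K^o) (u : K^o -> K^o) d -> u z != 0 ->
  exists2 r : K, 0 < r & forall h, `|h| < r -> u (z + h) != 0.
Proof.
move=> /is_derive_eps H uz; have [r1 r10 r1P] := H 1 ltr01.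
have nu : 0 < `|u z| by rewrite normr_gt0.
have d1 : 0 < 1 + `|d| by apply: ltr_wpDr => //; apply: normr_ge0.
(* A zero at z + h would give |u z| <= |h| (1 + |d|), which this radius excludes. *)
have [c c0 /andP[cr cu]] := pos_common_lower r10 (divr_gt0 nu d1).
exists c => // h hc; apply/eqP => uh.
have := r1P h (lt_le_trans hc cr).
rewrite uh sub0r mul1r -opprD normrN => le1.
have : `|u z| < `|u z|.
  rewrite -[X in `|X| < _](addrK (h * d)); apply: le_lt_trans (ler_normB _ _) _.
  apply: le_lt_trans (lerD le1 (lexx _)) _.
  rewrite normrM -[X in X + _]mulr1 -mulrDr -ltr_pdivlMr //.
  exact: lt_le_trans hc cu.
by rewrite ltxx.
Qed.

Section Calculus.

Lemma is_derive_bigsum (K : numFieldType) (J : Type) (r : seq J) (F : J -> K -> K) (dF : J -> K)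
    (x : K) :
  (forall i, is_derive (x : K^o) (1 : K^o) (F i : K^o -> K^o) (dF i)) ->
  is_derive (x : K^o) (1 : K^o) ((fun y => \sum_(i <- r) F i y) : K^o -> K^o) (\sum_(i <- r) dF i).
Proof.
move=> HF; elim: r => [|i r IH].
  rewrite big_nil (_ : (fun y => _) = cst 0); first exact: is_derive_cst.
  by apply/funext => y; rewrite big_nil.
rewrite big_cons (_ : (fun y => _) = (F i : K^o -> K^o) + (fun y => \sum_(i <- r) F i y)).
  exact: is_deriveD.
by apply/funext => y; rewrite big_cons.
Qed.

(** The sum N of the squares satisfies N' <= L N, so exp(-L t) N(t) does not increase from its
    initial value 0. Squares, unlike absolute values, are differentiable. *)
Lemma gronwall (R : realType) (J : finType) (a da : J -> R -> R) (c : R) :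
  0 <= c ->
  (forall k (t : R), 0 <= t <= 1 -> is_derive t (1 : R) (a k) (da k t)) ->
  (forall k (t : R), 0 <= t <= 1 -> `|da k t| <= c * \sum_j `|a j t|) ->
  (forall k, a k 0 = 0) -> forall k, a k 1 = 0.
Proof.
move=> c0 ader abd a0 k.
(* By 2 |a_j| |a_i| <= a_j^2 + a_i^2, summed over both indices, N' is at most 2 c #|J| N. *)
pose L : R := c * #|J|%:R *+ 2.
pose N (t : R) : R := \sum_j a j t ^+ 2.
pose dN (t : R) : R := \sum_j a j t * da j t *+ 2.
have Nder (t : R) : 0 <= t <= 1 -> is_derive t (1 : R) N (dN t).
  move=> t01; apply: (is_derive_bigsum (K := R)) => j.
  apply: is_derive_eq; first by apply: is_deriveM; exact: ader.
  by rewrite mulr2n.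
have dNle (t : R) : 0 <= t <= 1 -> dN t <= L * N t.
  move=> t01; apply: (@le_trans _ _ (\sum_j \sum_i c * (a j t ^+ 2 + a i t ^+ 2))).
    apply: ler_sum => j _.
    apply: (@le_trans _ _ (`|a j t| * (c * \sum_i `|a i t|) *+ 2)).
      rewrite lerMn2r /=; apply: le_trans (ler_norm _) _; rewrite normrM.
      by apply: ler_wpM2l => //; apply: abd.
    rewrite mulrCA mulr_sumr mulr_sumr -sumrMnl; apply: ler_sum => i _.
    rewrite -mulrnAr; apply: ler_wpM2l => //.
    have nsq (x : R) : x ^+ 2 = `|x| ^+ 2 by rewrite real_normK ?num_real.
    rewrite -subr_ge0 (nsq (a j t)) (nsq (a i t)).
    by rewrite addrAC -sqrrB sqr_ge0.
  rewrite le_eqVlt; apply/orP; left; apply/eqP.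
  under eq_bigr do rewrite -mulr_sumr big_split sumr_const /=.
  rewrite -mulr_sumr big_split sumr_const /= sumrMnl -/(N t) /L.
  have gen (x y z : R) : x * (y * z + y * z) = (x * z *+ 2) * y by ring.
  by rewrite -(mulr_natr (N t)) gen.
pose g (t : R) : R := expR (- L * t) * N t.
have gder (t : R) : 0 <= t <= 1 -> is_derive t (1 : R) g (expR (- L * t) * (dN t - L * N t)).
  move=> t01; have ? := Nder t t01.
  have eder : is_derive t (1 : R) (fun t => expR (- L * t)) (- L * expR (- L * t)).
    have lin : is_derive t (1 : R) (fun t => - L * t) (- L).
      exact: (is_derive_eq (@is_deriveZ R R R^o id (- L) t 1 1 (is_derive_id t 1)) (mulr1 _)).
    have := is_derive1_comp (is_derive_expR (- L * t)) lin.
    by move/is_derive_eq; apply; rewrite mulrC.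
  have := is_deriveM eder (Nder t t01).
  move/is_derive_eq; apply; rewrite /GRing.scale /=; ring.
have : g 1 <= g 0.
  have [|||x x01] := @MVT R g (fun t => expR (- L * t) * (dN t - L * N t)) 0 1.
  - exact: ltr01.
  - move=> x; rewrite in_itv /= => /andP[/ltW x0 /ltW x1].
    by apply: gder; rewrite x0.
  - apply: derivable_within_continuous => x; rewrite in_itv /= => x01.
    exact: (@ex_derive _ _ _ _ _ _ _ (gder x x01)).
  rewrite subr0 mulr1 => gE; rewrite -subr_le0 gE; apply: mulr_ge0_le0; first exact: expR_ge0.
  move: x01; rewrite in_itv /= => /andP[/ltW x0 /ltW x1].
  by rewrite subr_le0; apply: dNle; rewrite x0.
have -> : g 0 = 0 by rewrite /g /N big1 ?mulr0 // => j _; rewrite a0 expr0n.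
rewrite /g pmulr_rle0 ?expR_gt0 // => N1.
have : N 1 == 0 by rewrite eq_le N1 /N sumr_ge0 // => j _; apply: sqr_ge0.
rewrite psumr_eq0 => [/allP/(_ k)|j _]; last exact: sqr_ge0.
by rewrite mem_index_enum sqrf_eq0 => /(_ isT)/eqP.
Qed.

Lemma normr_complex (R : realType) (x : R[i]) : `|x| = (normc x)%:C.
Proof. by []. Qed.

Lemma normc_nonneg (R : realType) (x : R[i]) : 0 <= normc x.
Proof. by rewrite -lecR -normr_complex normr_ge0. Qed.

Lemma Re_le_normc (R : realType) (x : R[i]) : `|complex.Re x| <= normc x.
Proof. by rewrite -lecR -normr_complex normc_ge_Re. Qed.

Lemma normc_i (R : realType) : normc 'i%C = 1 :> R.
Proof. by rewrite /= expr0n expr1n add0r sqrtr1. Qed.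

(** The imaginary part is written as a real part of i x, so that a chain rule for real parts is
    enough. *)
Lemma normc_le_ReIm (R : realType) (x : R[i]) :
  normc x <= `|complex.Re x| + `|complex.Re ('i%C * x)|.
Proof.
rewrite -lecR -normr_complex rmorphD /= [in X in X <= _](complexE x).
apply: le_trans (ler_normD _ _) _; apply: lerD.
  by rewrite normr_complex /= expr0n addr0 sqrtr_sqr.
rewrite normrM normr_complex normc_i mul1r.
by rewrite mulrC ReiNIm normrN normr_complex /= expr0n addr0 sqrtr_sqr.
Qed.

Lemma pos_real_complex (R : realType) (e : R[i]) : 0 < e -> exists2 r : R, 0 < r & e = r%:C.
Proof.
case: e => a b; rewrite ltcE /= => /andP[/eqP -> a0]; by exists a.
Qed.

(** The bridge to real analysis: on segments, the mean value and extreme value theorems become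
    available. *)
Lemma is_derive_Re (R : realType) (u : R[i] -> R[i]) (z0 w d : R[i]) (t : R) :
  is_derive (z0 + t%:C * w : R[i]^o) (1 : R[i]^o) (u : R[i]^o -> R[i]^o) d ->
  is_derive t (1 : R) (fun s => complex.Re (u (z0 + s%:C * w))) (complex.Re (d * w)).
Proof.
move=> /is_derive_eps H; apply/(is_derive_eps (K := R)) => e e0.
(* The added 1 keeps the divisor positive when w = 0. *)
have w1 : 0 < normc w + 1 by apply: ltr_wpDl => //; exact: normc_nonneg.
have [|r0 r0p rP] := H (e / (normc w + 1))%:C.
  by rewrite ltcR divr_gt0.
have [r rp rE] := pos_real_complex r0p.
exists (r / (normc w + 1)); first by rewrite divr_gt0.
move=> h; rewrite ltr_pdivlMr // => hr.
have hw : `|h%:C * w| = (`|h| * normc w)%:C.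
  by rewrite normrM normr_complex /= expr0n addr0 sqrtr_sqr rmorphM.
have hlt : `|h%:C * w| < r0.
  by rewrite hw rE ltcR; apply: le_lt_trans hr; rewrite ler_wpM2l // lerDl.
have le_e := rP _ hlt; rewrite hw in le_e.
have -> : complex.Re (u (z0 + (t + h)%:C * w)) - complex.Re (u (z0 + t%:C * w)) - h * complex.Re (d * w)
  = complex.Re (u (z0 + t%:C * w + h%:C * w) - u (z0 + t%:C * w) - h%:C * w * d).
  rewrite !raddfB /= rmorphD mulrDl addrA; congr (_ - _ - _).
  rewrite -mulrA [w * d]mulrC; case: (d * w) => x y /=.
  by rewrite mul0r subr0.
apply: le_trans (Re_le_normc _) _.
move: le_e; rewrite normr_complex -rmorphM lecR => /le_trans; apply.
rewrite -mulrA [_^-1 * _]mulrC ler_pM2l // ler_pdivrMr // ler_wpM2l //.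
by rewrite lerDl.
Qed.

Lemma segment_bounded (R : realType) (u d : R[i] -> R[i]) (z0 w : R[i]) :
  (forall t : R, 0 <= t <= 1 ->
    is_derive (z0 + t%:C * w : R[i]^o) (1 : R[i]^o) (u : R[i]^o -> R[i]^o) (d (z0 + t%:C * w))) ->
  exists2 b : R, 0 <= b & forall t : R, 0 <= t <= 1 -> normc (u (z0 + t%:C * w)) <= b.
Proof.
move=> ud.
have H (v : R[i] -> R[i]) (dv : R[i] -> R[i]) : (forall t : R, 0 <= t <= 1 ->
    is_derive (z0 + t%:C * w : R[i]^o) (1 : R[i]^o) (v : R[i]^o -> R[i]^o) (dv (z0 + t%:C * w))) ->
  exists2 b : R, 0 <= b & forall t : R, 0 <= t <= 1 -> `|complex.Re (v (z0 + t%:C * w))| <= b.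
  move=> vd; pose f (t : R) := complex.Re (v (z0 + t%:C * w)).
  have cf : {within `[0, 1], continuous (fun t => `|f t|)}.
    move=> x; apply: continuous_comp; last exact: norm_continuous.
    move: x; apply: derivable_within_continuous => x; rewrite in_itv /= => x01.
    exact: (@ex_derive _ _ _ _ _ _ _ (is_derive_Re (vd x x01))).
  have [c c01 cmax] := EVT_max ler01 cf.
  exists (`|f c|) => // t t01; apply: cmax; by rewrite in_itv.
have [b1 b10 b1P] := H u d ud.
have [|b2 b20 b2P] := H (fun z => 'i%C * u z) (fun z => 'i%C * d z).
  move=> t t01; exact: is_deriveZ (ud t t01).
exists (b1 + b2); first exact: addr_ge0.
move=> t t01; apply: le_trans (normc_le_ReIm _) _; apply: lerD; [exact: b1P | exact: b2P].
Qed.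

Lemma linear_ode_zero (R : realType) m (u : 'I_m -> R[i] -> R[i])
    (B dB : 'I_m -> 'I_m -> R[i] -> R[i]) (z0 w : R[i]) :
  (forall k (t : R), 0 <= t <= 1 -> let z := z0 + t%:C * w in
    is_derive (z : R[i]^o) (1 : R[i]^o) (u k : R[i]^o -> R[i]^o) (\sum_j B k j z * u j z)) ->
  (forall k j (t : R), 0 <= t <= 1 -> let z := z0 + t%:C * w in
    is_derive (z : R[i]^o) (1 : R[i]^o) (B k j : R[i]^o -> R[i]^o) (dB k j z)) ->
  (forall k, u k z0 = 0) -> forall k, u k (z0 + w) = 0.
Proof.
move=> uder Bder u0 k.
have /choice[b0 b0P] (kj : 'I_m * 'I_m) : exists b : R, 0 <= b /\
    forall t : R, 0 <= t <= 1 -> normc (B kj.1 kj.2 (z0 + t%:C * w)) <= b.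
  by have [b ? ?] := segment_bounded (Bder kj.1 kj.2); exists b.
pose b := \sum_kj b0 kj.
have bP k' j (t : R) : 0 <= t <= 1 -> normc (B k' j (z0 + t%:C * w)) <= b.
  move=> t01; apply: le_trans ((b0P (k', j)).2 t t01) _.
  by rewrite /b (bigD1 (k', j)) //= lerDl sumr_ge0 // => i _; have [] := b0P i.
have b_ge0 : 0 <= b by apply: sumr_ge0 => i _; have [] := b0P i.
(* The real unknowns fed to [gronwall] are the real parts of u_k and of i u_k. *)
pose rot (s : bool) : R[i] := if s then 'i%C else 1.
have nrot s : normc (rot s) = 1.
  by case: s; [exact: normc_i | rewrite /= expr0n expr1n addr0 sqrtr1].
pose a (ks : 'I_m * bool) (t : R) := complex.Re (rot ks.2 * u ks.1 (z0 + t%:C * w)).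
pose da (ks : 'I_m * bool) (t : R) :=
  complex.Re (rot ks.2 * (\sum_j B ks.1 j (z0 + t%:C * w) * u j (z0 + t%:C * w)) * w).
have nu j t : normc (u j (z0 + t%:C * w)) <= \sum_s `|a (j, s) t|.
  by apply: le_trans (normc_le_ReIm _) _; rewrite big_bool /= addrC /a /= mul1r.
have a1 : forall ks, a ks 1 = 0.
  apply: (@gronwall R _ a da (normc w * b)).
  - by apply: mulr_ge0 => //; exact: normc_nonneg.
  - move=> ks t t01; apply: (is_derive_Re (u := fun z => rot ks.2 * u ks.1 z)).
    exact: is_deriveZ (uder ks.1 t t01).
  - move=> ks t t01; apply: le_trans (Re_le_normc _) _.
    rewrite !ComplexField.Normc.normcM nrot mul1r mulrC -mulrA.
    apply: ler_wpM2l; first exact: normc_nonneg.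
    rewrite (_ : \sum_j `|a j t| = \sum_j \sum_s `|a (j, s) t|); last first.
      by rewrite pair_bigA; apply: eq_bigr => -[].
    rewrite mulr_sumr -lecR -normr_complex rmorph_sum; apply: le_trans (ler_norm_sum _ _ _) _.
    apply: ler_sum => j _; rewrite normr_complex lecR ComplexField.Normc.normcM.
    by apply: ler_pM => //; [exact: normc_nonneg | exact: normc_nonneg | exact: bP].
  - by move=> ks; rewrite /a mul0r addr0 u0 mulr0.
apply/eqP; rewrite -normr_eq0 normr_complex; apply/eqP; congr (_%:C); apply/eqP.
rewrite eq_le normc_nonneg andbT.
have := nu k 1; rewrite mul1r => /le_trans; apply.
by rewrite big1 // => s _; rewrite a1 normr0.
Qed.
End Calculus.

(** * Lie derivatives along curves *)

Lemma mpoly_alg_ind n (F : comNzRingType) (P : mpoly n F -> Prop) :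
  (forall c, P (mpolyC n c)) -> (forall i, P (mpolyX F (mnm1 i))) ->
  (forall f g, P f -> P g -> P (f + g)) -> (forall f g, P f -> P g -> P (f * g)) ->
  forall f, P f.
Proof.
move=> PC PX PD PM f; elim/mpolyind: f => [|c m f _ _ IH]; first by rewrite -(mpolyC0 n F).
apply: (PD) => //; rewrite -mul_mpolyC; apply: (PM) => //.
rewrite mpolyXE_id; apply: (big_ind P) => [||i _]; [by rewrite -(mpolyC1 n F)|exact: PM|].
elim: (m i) => [|k IHk]; first by rewrite expr0 -(mpolyC1 n F).
by rewrite exprS; apply: PM.
Qed.

Section Lie.
Context (F : comNzRingType) (N : nat) (xi : 'I_N -> mpoly N F).

Definition lie (f : mpoly N F) : mpoly N F := \sum_i xi i * mderiv i f.

Lemma lieD f g : lie (f + g) = lie f + lie g.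
Proof. by rewrite /lie -big_split; apply: eq_bigr => i _; rewrite mderivD mulrDr. Qed.

Lemma lieC c : lie (mpolyC N c) = 0.
Proof. by rewrite /lie big1 // => i _; rewrite mderivC mulr0. Qed.

Lemma lie0 : lie 0 = 0.
Proof. by rewrite -(mpolyC0 N F) lieC. Qed.

Lemma lieM f g : lie (f * g) = lie f * g + f * lie g.
Proof.
rewrite /lie mulr_suml mulr_sumr -big_split; apply: eq_bigr => i _ /=.
by rewrite mderivM mulrDr !mulrA [f * xi i]mulrC.
Qed.

Lemma lieX i : lie (mpolyX F (mnm1 i)) = xi i.
Proof.
rewrite /lie (bigD1 i) //= big1 => [|j ne].
  rewrite mderivX mnm1E eqxx (_ : mnm_sub _ _ = mnm0); last by apply/mnmP => j; rewrite !mnmE subnn.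
  by rewrite mpolyX0 scale1r addr0 mulr1.
by rewrite mderivX mnm1E eq_sym (negPf ne) scale0r mulr0.
Qed.

Lemma lie_sum I (r : seq I) (P : pred I) (G : I -> mpoly N F) :
  lie (\sum_(i <- r | P i) G i) = \sum_(i <- r | P i) lie (G i).
Proof. exact: (big_morph _ lieD lie0). Qed.

Lemma lieZ c f : lie (c *: f) = c *: lie f.
Proof. by rewrite -!mul_mpolyC lieM lieC mul0r add0r. Qed.

Lemma iter_lieD k f g : iter k lie (f + g) = iter k lie f + iter k lie g.
Proof. by elim: k => //= k ->; rewrite lieD. Qed.

Lemma iter_lieZ k c f : iter k lie (c *: f) = c *: iter k lie f.
Proof. by elim: k => //= k ->; rewrite lieZ. Qed.

Lemma iter_lie_sum k I (r : seq I) (P : pred I) (G : I -> mpoly N F) :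
  iter k lie (\sum_(i <- r | P i) G i) = \sum_(i <- r | P i) iter k lie (G i).
Proof. by elim: k => //= k ->; rewrite lie_sum. Qed.
End Lie.

(** Both [h \o lie xi] and [lie eta \o h] are derivations over h, so comparing them on constants and
    variables suffices. *)
Lemma lie_intertwine (F G : comNzRingType) N M (xi : 'I_N -> mpoly N F)
    (eta : 'I_M -> mpoly M G) (h : {rmorphism mpoly N F -> mpoly M G}) :
  (forall c, lie eta (h (mpolyC N c)) = 0) ->
  (forall i, lie eta (h (mpolyX F (mnm1 i))) = h (xi i)) ->
  forall f k, h (iter k (lie xi) f) = iter k (lie eta) (h f).
Proof.
move=> hC hX; suff H f : h (lie xi f) = lie eta (h f).
  by move=> f; elim=> //= k <-; rewrite H.
elim/mpoly_alg_ind: f => [c|i|f g IHf IHg|f g IHf IHg].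
- by rewrite lieC rmorph0.
- by rewrite lieX.
- by rewrite lieD !rmorphD lieD IHf IHg.
- by rewrite lieM rmorphD !rmorphM lieM IHf IHg.
Qed.

Definition flat (F : fieldType) N (xi : vector_field F N) (x : 'rV[F]_N) (f : mpoly N F) :=
  forall k, eval (iter k (lie xi) f) x = 0.

Lemma flatM (F : fieldType) N (xi : vector_field F N) x g f :
  flat xi x f -> flat xi x (g * f).
Proof.
move=> fl k; elim: k g f fl => [|k IH] g f fl.
  by rewrite /eval mevalM -/(eval f x) (fl 0%N) mulr0.
rewrite iterSr lieM iter_lieD /eval mevalD -!/(eval _ _) !IH ?addr0 //.
by move=> j; rewrite -iterSr fl.
Qed.

Section Curves.
Context (R : realType) (N : nat) (xi : vector_field R[i] N).
Implicit Types (phi : R[i] -> 'rV[R[i]]_N) (c r z w : R[i]) (f : mpoly N R[i]).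

Definition solves phi z := forall i,
  is_derive (z : R[i]^o) (1 : R[i]^o) ((fun w => phi w 0 i) : R[i]^o -> R[i]^o)
    (eval (xi i) (phi z)).

Lemma is_derive_eval phi z f : solves phi z ->
  is_derive (z : R[i]^o) (1 : R[i]^o) ((fun w => eval f (phi w)) : R[i]^o -> R[i]^o)
    (eval (lie xi f) (phi z)).
Proof.
move=> sol; elim/mpoly_alg_ind: f => [c|i|f g IHf IHg|f g IHf IHg].
- rewrite lieC {2}/eval meval0 (_ : (fun _ => _) = cst c); first exact: is_derive_cst.
  by apply/funext => w; rewrite /eval mevalC.
- rewrite lieX (_ : (fun _ => _) = (fun w => phi w 0 i)); first exact: sol.
  by apply/funext => w; rewrite /eval mevalXU.
- rewrite (_ : (fun _ => _) = ((fun w => eval f (phi w)) : R[i]^o -> R[i]^o) + (fun w => eval g (phi w))).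
    by rewrite lieD {3}/eval mevalD; apply: is_deriveD.
  by apply/funext => w; rewrite /eval mevalD.
- rewrite (_ : (fun _ => _) = ((fun w => eval f (phi w)) : R[i]^o -> R[i]^o) * (fun w => eval g (phi w))).
    have := is_deriveM IHf IHg; move/is_derive_eq; apply.
    by rewrite lieM /eval mevalD !mevalM /GRing.scale /= addrC [X in X + _]mulrC.
  by apply/funext => w; rewrite /eval mevalM.
Qed.

(* The iterated Lie derivatives of f generate a finitely generated ideal, so finitely
   many of them solve a linear homogeneous differential system along the curve. *)
Lemma flat_segment phi z w f :
  (forall t : R, 0 <= t <= 1 -> solves phi (z + t%:C * w)) ->
  flat xi (phi z) f -> flat xi (phi (z + w)) f.
Proof.
move=> sol fl k0.
have {fl} : flat xi (phi z) (iter k0 (lie xi) f) by move=> k; rewrite -iterD.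
move: (iter k0 _ _) => {k0}f fl.
have [[|m] [c cE]] := ideal_chain (fun k => iter k (lie xi) f).
  by move: cE; rewrite /= big_ord0 => ->; rewrite /eval meval0.
(* A companion matrix: each Lie derivative is followed by the next, and the relation [cE] rewrites
   the derivative of the last one. *)
pose B (k j : 'I_m.+1) : mpoly N R[i] :=
  if (k.+1 < m.+1)%N then (j == k.+1 :> nat)%:R else c j.
have := @linear_ode_zero R m.+1 (fun k z => eval (iter k (lie xi) f) (phi z))
  (fun k j z => eval (B k j) (phi z)) (fun k j z => eval (lie xi (B k j)) (phi z)) z w.
move=> /(_ _ _ _ ord0); apply.
- move=> k t t01 zt; apply: is_derive_eq; first exact: is_derive_eval (sol t t01).
  rewrite -/(iter k.+1 (lie xi) f); rewrite /B; case: ltnP => [lt|ge].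
    rewrite (bigD1 (Ordinal lt)) //= eqxx /eval meval1 mul1r big1 ?addr0 // => j.
    by rewrite -val_eqE /= => /negPf ->; rewrite meval0 mul0r.
  have -> : k.+1 = m.+1 by apply/eqP; rewrite eqn_leq ge ltn_ord.
  by rewrite cE /eval raddf_sum; apply: eq_bigr => j _; rewrite /= mevalM.
- by move=> k j t t01 zt; apply: is_derive_eval (sol t t01).
- by move=> k; apply: fl.
Qed.

(** Discs are convex, so flatness travels along the segment from z to w. *)
Lemma flat_ball phi c r z w f : (forall z, `|c - z| < r -> solves phi z) ->
  `|c - z| < r -> `|c - w| < r -> flat xi (phi z) f -> flat xi (phi w) f.
Proof.
move=> sol zc wc fl; rewrite -[w](subrK z) addrC; apply: flat_segment => // t /andP[t0 t1].
apply: sol.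
have -> : c - (z + t%:C * (w - z)) = (1 - t%:C) * (c - z) + t%:C * (c - w) by ring.
have t0C : 0 <= t%:C by rewrite lecR.
have t1C : 0 <= 1 - t%:C by rewrite subr_ge0 lecR.
apply: le_lt_trans (ler_normD _ _) _; rewrite !normrM (ger0_norm t0C) (ger0_norm t1C).
have [->|tn0] := eqVneq t 0; first by rewrite subr0 mul0r mul1r addr0.
have tpos : 0 < t%:C by rewrite ltcR lt0r tn0.
have -> : r = (1 - t%:C) * r + t%:C * r by ring.
by apply: ler_ltD; [apply: ler_wpM2l => //; exact: ltW | rewrite ltr_pM2l].
Qed.

Lemma vanish_flat phi c r f : (forall z, `|c - z| < r -> solves phi z) ->
  (forall z, `|c - z| < r -> eval f (phi z) = 0) ->
  forall z, `|c - z| < r -> flat xi (phi z) f.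
Proof.
move=> sol f0; suff H k : forall z, `|c - z| < r -> eval (iter k (lie xi) f) (phi z) = 0.
  by move=> z zc k; apply: H.
elim: k => // k IH z zc /=; apply: (is_derive_near0 (is_derive_eval (iter k (lie xi) f) (sol z zc))).
exists (r - `|c - z|) => [|h hr]; first by rewrite subr_gt0.
apply: IH; rewrite opprD addrA; apply: le_lt_trans (ler_normB _ _) _.
by rewrite -ltrBrDl.
Qed.
End Curves.

(** * Power series and local solutions *)

Section PowerSeries.
Context (R : realType).
Local Notation C := R[i].

Lemma normc_sum I (r : seq I) (P : pred I) (F : I -> C) :
  normc (\sum_(i <- r | P i) F i) <= \sum_(i <- r | P i) normc (F i).
Proof. by rewrite -lecR -normr_complex rmorph_sum; apply: ler_norm_sum. Qed.

Lemma normcX (x : C) k : normc (x ^+ k) = normc x ^+ k.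
Proof. by apply: (@complexI R); rewrite -normr_complex normrX rmorphXn. Qed.

Lemma normcB (x y : C) : normc (x - y) = normc (y - x).
Proof. by apply: (@complexI R); rewrite -!normr_complex distrC. Qed.

Lemma normc_nat k : normc (k%:R : C) = k%:R.
Proof. by apply: (@complexI R); rewrite -normr_complex normr_nat rmorph_nat. Qed.

Definition clim (u : nat -> C) (l : C) := forall e : R, 0 < e ->
  exists n0, forall n, (n0 <= n)%N -> normc (u n - l) <= e.

Lemma clim_unique u l l' : clim u l -> clim u l' -> l = l'.
Proof.
move=> ul ul'; apply/eqP; rewrite -subr_eq0 -normr_eq0 normr_complex.
suff H : normc (l - l') <= 0 by rewrite (_ : normc _ = 0) //; apply/eqP; rewrite eq_le H normc_nonneg.
apply/ler_addgt0Pr => e e0; rewrite add0r.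
have [n0 h0] := ul _ (divr_gt0 e0 (ltr0Sn _ 1)); have [n1 h1] := ul' _ (divr_gt0 e0 (ltr0Sn _ 1)).
set n := maxn n0 n1.
have -> : l - l' = (l - u n) + (u n - l') by ring.
apply: le_trans (le_normcD _ _) _; rewrite [X in _ <= X]splitr normcB.
by apply: lerD; [apply: h0; apply: leq_maxl | apply: h1; apply: leq_maxr].
Qed.

Lemma climD u v l l' : clim u l -> clim v l' -> clim (fun n => u n + v n) (l + l').
Proof.
move=> ul vl e e0.
have [n0 h0] := ul _ (divr_gt0 e0 (ltr0Sn _ 1)); have [n1 h1] := vl _ (divr_gt0 e0 (ltr0Sn _ 1)).
exists (maxn n0 n1) => n; rewrite geq_max => /andP[le0 le1].
have -> : u n + v n - (l + l') = (u n - l) + (v n - l') by ring.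
apply: le_trans (le_normcD _ _) _; rewrite [X in _ <= X]splitr.
by apply: lerD; [apply: h0 | apply: h1].
Qed.

Lemma climZ a u l : clim u l -> clim (fun n => a * u n) (a * l).
Proof.
move=> ul e e0; have a1 : 0 < normc a + 1 by apply: ltr_wpDl => //; exact: normc_nonneg.
have [n0 h0] := ul _ (divr_gt0 e0 a1); exists n0 => n /h0 le.
rewrite -mulrBr ComplexField.Normc.normcM.
apply: (@le_trans _ _ ((normc a + 1) * normc (u n - l))).
  by apply: ler_wpM2r; [exact: normc_nonneg | rewrite lerDl].
by rewrite mulrC -ler_pdivlMr.
Qed.

Lemma clim_bounded u l : clim u l -> exists2 b : R, 0 <= b &
  normc l <= b /\ exists n0, forall n, (n0 <= n)%N -> normc (u n) <= b.
Proof.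
move=> ul; have [n0 h0] := ul 1 ltr01; exists (1 + normc l).
  by apply: addr_ge0 => //; exact: normc_nonneg.
split; first by rewrite lerDr.
exists n0 => n /h0 le; rewrite -[u n](subrK l).
by apply: le_trans (le_normcD _ _) _; apply: lerD.
Qed.

Lemma climM u v l l' : clim u l -> clim v l' -> clim (fun n => u n * v n) (l * l').
Proof.
move=> ul vl; have [b b0 [_ [n1 ub]]] := clim_bounded ul.
move=> e e0; have b1 : 0 < b + 1 by apply: ltr_wpDl.
have l1 : 0 < normc l' + 1 by apply: ltr_wpDl => //; exact: normc_nonneg.
have e2 : 0 < e / 2 by rewrite divr_gt0.
have [n2 h2] := ul _ (divr_gt0 e2 l1); have [n3 h3] := vl _ (divr_gt0 e2 b1).
exists (maxn n1 (maxn n2 n3)) => n; rewrite !geq_max => /and3P[/ub u1 /h2 u2 /h3 u3].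
have -> : u n * v n - l * l' = u n * (v n - l') + (u n - l) * l' by ring.
apply: le_trans (le_normcD _ _) _; rewrite [X in _ <= X]splitr.
rewrite !ComplexField.Normc.normcM; apply: lerD.
  apply: (@le_trans _ _ ((b + 1) * (e / 2 / (b + 1)))); last by rewrite mulrC divfK ?gt_eqF.
  by apply: ler_pM; rewrite ?normc_nonneg // (le_trans u1) // lerDl.
apply: (@le_trans _ _ ((e / 2 / (normc l' + 1)) * (normc l' + 1))); last by rewrite divfK ?gt_eqF.
by apply: ler_pM; rewrite ?normc_nonneg // lerDl.
Qed.

Lemma clim_le u l b : clim u l -> (forall n, normc (u n) <= b) -> normc l <= b.
Proof.
move=> ul ub; apply/ler_addgt0Pr => e e0; have [n0 h0] := ul e e0.
have -> : l = u n0 - (u n0 - l) by ring.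
apply: le_trans (le_normcD _ _) _.
by rewrite normcN; apply: lerD => //; apply: h0.
Qed.

Lemma clim_shift u l k : clim u l -> clim (fun n => u (n + k)%N) l.
Proof.
move=> ul e e0; have [n0 h0] := ul e e0; exists n0 => n le; apply: h0.
exact: leq_trans (leq_addr _ _).
Qed.

Lemma clim_near u v l : clim u l -> clim (fun n => v n - u n) 0 -> clim v l.
Proof.
move=> ul vl; have := climD ul vl; rewrite addr0; congr (clim _ _).
by apply/funext => n; ring.
Qed.

Lemma real_summable (x : nat -> R) b : (forall n, \sum_(k < n) `|x k| <= b) ->
  exists s : R, forall e, 0 < e -> exists n0, forall n, (n0 <= n)%N -> `|\sum_(k < n) x k - s| <= e.
Proof.
move=> xb; have cv : cvgn (series x).
  apply: normed_cvg; apply: nondecreasing_is_cvgn.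
    by apply: (@nondecreasing_series _ (fun k => `|x k|) xpredT) => k _ _; apply: normr_ge0.
  by exists b => _ [n _ <-]; have := xb n; rewrite -(big_mkord xpredT (fun k => `|x k|)).
exists (limn (series x)) => e e0.
have /cvgrPdist_le/(_ e e0)[n0 _ h0] := cv.
exists n0 => n le; have := h0 n le; rewrite /= distrC /series /= big_mkord.
by [].
Qed.

Lemma complex_summable (x : nat -> C) (b : R) : (forall n, \sum_(k < n) normc (x k) <= b) ->
  exists s, clim (fun n => \sum_(k < n) x k) s.
Proof.
move=> xb; have [|s1 h1] := @real_summable (fun k => complex.Re (x k)) b.
  by move=> n; apply: le_trans (xb n); apply: ler_sum => k _; apply: Re_le_normc.
have [|s2 h2] := @real_summable (fun k => complex.Re ('i%C * x k)) b.
  move=> n; apply: le_trans (xb n); apply: ler_sum => k _.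
  by apply: le_trans (Re_le_normc _) _; rewrite ComplexField.Normc.normcM normc_i mul1r.
exists (s1%:C - 'i%C * s2%:C) => e e0.
have e2 : 0 < e / 2 by rewrite divr_gt0.
have [n1 k1] := h1 _ e2; have [n2 k2] := h2 _ e2.
exists (maxn n1 n2) => n; rewrite geq_max => /andP[le1 le2].
have ReB (v w : C) : complex.Re (v - w) = complex.Re v - complex.Re w by case: v w => ? ? [].
have ReS n' (y : nat -> C) : complex.Re (\sum_(k < n') y k) = \sum_(k < n') complex.Re (y k).
  by apply: (big_morph _ (id1 := 0)) => // -[? ?] [].
have E1 : complex.Re (s1%:C - 'i%C * s2%:C) = s1 by rewrite /=; ring.
have E2 : complex.Re ('i%C * (s1%:C - 'i%C * s2%:C)) = s2 by rewrite /=; ring.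
apply: le_trans (normc_le_ReIm _) _; rewrite [X in _ <= X]splitr; apply: lerD.
  by rewrite ReB ReS E1; apply: k1.
by rewrite mulrBr mulr_sumr ReB (ReS n (fun k => 'i%C * x k)) E2; apply: k2.
Qed.

(* The discarded terms have degree at least n, so halving the radius gives the
   factor 2^-n. *)
Lemma cauchy_product_partial (a b : nat -> C) (r A B : R) (z : C) n : 0 <= r ->
  \sum_(k < n) normc (a k) * r ^+ k <= A -> \sum_(k < n) normc (b k) * r ^+ k <= B ->
  normc z <= r / 2 ->
  normc (\sum_(k < n) (\sum_(j < k.+1) a j * b (k - j)%N) * z ^+ k -
         (\sum_(k < n) a k * z ^+ k) * (\sum_(k < n) b k * z ^+ k)) <= (A * B) / 2 ^+ n.
Proof.
move=> r0 aA bB zr.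
pose P := \poly_(k < n) a k; pose Q := \poly_(k < n) b k.
pose P' := \poly_(k < n) normc (a k); pose Q' := \poly_(k < n) normc (b k).
have sPQ : (size (P * Q)%R <= n + n)%N.
  apply: leq_trans (size_polyMleq _ _) _; apply: leq_trans (leq_pred _) _.
  by apply: leq_add; apply: size_poly.
have sPQ' : (size (P' * Q')%R <= n + n)%N.
  apply: leq_trans (size_polyMleq _ _) _; apply: leq_trans (leq_pred _) _.
  by apply: leq_add; apply: size_poly.
have coef_le k : normc (P * Q)`_k <= (P' * Q')`_k.
  rewrite !coefM; apply: le_trans (normc_sum _ _ _) _; apply: ler_sum => j _.
  rewrite ComplexField.Normc.normcM !coef_poly.
  by do 2 case: ltnP => // _; rewrite ?ComplexField.Normc.normc0 ?mulr0 ?mul0r.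
have coef0 k : 0 <= (P' * Q')`_k by apply: le_trans (coef_le k); apply: normc_nonneg.
rewrite -!horner_poly -/P -/Q -hornerM (horner_coef_wide _ sPQ) big_split_ord /=.
have -> : \sum_(i < n) (P * Q)`_i * z ^+ i =
    \sum_(k < n) (\sum_(j < k.+1) a j * b (k - j)%N) * z ^+ k.
  apply: eq_bigr => k _; congr (_ * _); rewrite coefM; apply: eq_bigr => j _.
  rewrite !coef_poly (leq_ltn_trans _ (ltn_ord k)) ?(leq_ltn_trans (leq_subr j k)) //.
  by rewrite -ltnS.
rewrite opprD addNKr normcN; apply: le_trans (normc_sum _ _ _) _.
apply: (@le_trans _ _ (\sum_(i < n) (P' * Q')`_(n + i) * (r ^+ (n + i) / 2 ^+ n))).
  apply: ler_sum => i _; rewrite ComplexField.Normc.normcM; apply: ler_pM; rewrite ?normc_nonneg //.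
  rewrite normcX; apply: (@le_trans _ _ ((r / 2) ^+ (n + i))).
    by apply: lerXn2r => //; rewrite nnegrE ?normc_nonneg // divr_ge0.
  rewrite exprMn exprVn; apply: ler_wpM2l; first exact: exprn_ge0.
  rewrite lef_pV2 ?posrE ?exprn_gt0 // ler_eXn2l ?ltr1n ?leq_addr //.
under eq_bigr do rewrite mulrA; rewrite -mulr_suml ler_pM2r ?invr_gt0 ?exprn_gt0 //.
apply: (@le_trans _ _ (P'.[r] * Q'.[r])).
  rewrite -hornerM (horner_coef_wide _ sPQ') big_split_ord /= lerDr.
  by apply: sumr_ge0 => i _; apply: mulr_ge0 => //; apply: exprn_ge0.
by rewrite !horner_poly; apply: ler_pM => //; apply: sumr_ge0 => k _; apply: mulr_ge0;
  rewrite ?normc_nonneg ?exprn_ge0.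
Qed.

Lemma cauchy_product_bound (a b : nat -> C) (r A B : R) n : 0 <= r ->
  \sum_(k < n) normc (a k) * r ^+ k <= A -> \sum_(k < n) normc (b k) * r ^+ k <= B ->
  \sum_(k < n) normc (\sum_(j < k.+1) a j * b (k - j)%N) * r ^+ k <= A * B.
Proof.
move=> r0 aA bB.
pose P := \poly_(k < n) normc (a k); pose Q := \poly_(k < n) normc (b k).
have sPQ : (size (P * Q)%R <= n + n)%N.
  apply: leq_trans (size_polyMleq _ _) _; apply: leq_trans (leq_pred _) _.
  by apply: leq_add; apply: size_poly.
have coef0 k : 0 <= (P * Q)`_k.
  rewrite coefM; apply: sumr_ge0 => j _; rewrite !coef_poly.
  by apply: mulr_ge0; case: ifP => // _; apply: normc_nonneg.
apply: (@le_trans _ _ (P.[r] * Q.[r])); last first.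
  by rewrite !horner_poly; apply: ler_pM => //; apply: sumr_ge0 => k _; apply: mulr_ge0;
  rewrite ?normc_nonneg ?exprn_ge0.
rewrite -hornerM (horner_coef_wide _ sPQ) big_split_ord /=.
rewrite -[X in X <= _]addr0; apply: lerD; last first.
  by apply: sumr_ge0 => i _; apply: mulr_ge0 => //; apply: exprn_ge0.
apply: ler_sum => k _; apply: ler_wpM2r; first exact: exprn_ge0.
apply: le_trans (normc_sum _ _ _) _; rewrite coefM; apply: ler_sum => j _.
have jk : (j <= k)%N by rewrite -ltnS.
rewrite ComplexField.Normc.normcM !coef_poly (leq_ltn_trans jk (ltn_ord k)).
by rewrite (leq_ltn_trans (leq_subr j k) (ltn_ord k)).
Qed.

Lemma clim_geometric (u : nat -> C) (b : R) : (forall n, normc (u n) <= b / 2 ^+ n) -> clim u 0.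
Proof.
move=> ub e e0; have : (fun n => b / 2 ^+ n) @ \oo --> (0 : R).
  rewrite -[X in _ --> X](mulr0 b); apply: cvgMr.
  rewrite (_ : (fun n => _) = (fun n => 2^-1 ^+ n)); last by apply/funext => n; rewrite exprVn.
  by apply: cvg_expr; rewrite ger0_norm ?invr_ge0 // invf_lt1 // ltr1n.
move=> /cvgrPdist_le/(_ e e0)[n0 _ h0]; exists n0 => n le.
rewrite subr0; apply: le_trans (ub n) _; have := h0 n le.
by rewrite /= sub0r normrN; apply: le_trans; apply: ler_norm.
Qed.

(** The factor (k+2)(k+1) is chosen to match two Lie derivatives: multiplied by the coefficient of
    index k+2 of f, it gives that of index k of [lie xi (lie xi f)], whose series is bounded. *)
Lemma pow_taylor2 (z h : C) (r : R) k : normc z <= r -> normc (z + h) <= r ->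
  normc ((z + h) ^+ k.+2 - z ^+ k.+2 - k.+2%:R * h * z ^+ k.+1) <=
    normc h ^+ 2 * (k.+2 * k.+1)%:R * r ^+ k.
Proof.
move=> zr zhr; have r0 : 0 <= r by apply: le_trans zr; apply: normc_nonneg.
elim: k => [|k IH].
  rewrite (_ : _ - _ = h ^+ 2); last by ring.
  by rewrite normcX expr0 mulr1 ler_peMr ?exprn_ge0 ?normc_nonneg // ler1n.
have -> : (z + h) ^+ k.+3 - z ^+ k.+3 - k.+3%:R * h * z ^+ k.+2 =
  (z + h) * ((z + h) ^+ k.+2 - z ^+ k.+2 - k.+2%:R * h * z ^+ k.+1) + k.+2%:R * h ^+ 2 * z ^+ k.+1.
  by rewrite !exprS -!natr1; ring.
apply: le_trans (le_normcD _ _) _.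
rewrite (ComplexField.Normc.normcM (z + h)) (ComplexField.Normc.normcM (_ * _)) (ComplexField.Normc.normcM _%:R) !normcX normc_nat.
apply: (@le_trans _ _ (r * (normc h ^+ 2 * (k.+2 * k.+1)%:R * r ^+ k) + k.+2%:R * normc h ^+ 2 * r ^+ k.+1)).
  apply: lerD; first by apply: ler_pM; rewrite ?normc_nonneg.
  apply: ler_wpM2l; first by rewrite mulr_ge0 ?ler0n ?exprn_ge0 ?normc_nonneg.
  by apply: lerXn2r => //; rewrite nnegrE normc_nonneg.
have -> : r * (normc h ^+ 2 * (k.+2 * k.+1)%:R * r ^+ k) + k.+2%:R * normc h ^+ 2 * r ^+ k.+1
  = normc h ^+ 2 * (k.+2 * k.+2)%:R * r ^+ k.+1.
  rewrite !natrM -[k.+2]addn1 -[k.+1]addn1 !natrD exprD expr1; ring.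
apply: ler_wpM2r; first exact: exprn_ge0.
apply: ler_wpM2l; first by rewrite exprn_ge0 ?normc_nonneg.
by rewrite ler_nat leq_mul2r leqnSn orbT.
Qed.
End PowerSeries.

(** * Majorants of iterated Lie derivatives and convergence of Lie series *)

Section LieSeries.
Context (R : realType) (N : nat) (xi : vector_field R[i] N).
Local Notation C := R[i].
Implicit Types (f g : mpoly N C) (p : 'rV[C]_N).

(** Any expression of f as a list of terms is allowed, repeated monomials included, so that bounds
    pass through sums and products without collecting terms. *)
Definition majorized d (B : R) f := exists s : seq (C * multinom N),
  [/\ f = \sum_(x <- s) x.1 *: mpolyX C x.2, (forall x, x \in s -> (mdeg x.2 <= d)%N) &
      \sum_(x <- s) normc x.1 <= B].

Lemma majorized_ex f : exists d B, majorized d B f.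
Proof.
exists (msize f), (\sum_(m <- msupp f) normc f@_m), [seq (f@_m, m) | m <- msupp f].
split; first by rewrite big_map -mpolyE.
  by move=> _ /mapP[m mf ->] /=; apply/ltnW/msize_mdeg_lt.
by rewrite big_map.
Qed.

Lemma majorized_sum (J : eqType) (r : seq J) d (B : J -> R) (G : J -> mpoly N C) :
  (forall j, j \in r -> majorized d (B j) (G j)) ->
  majorized d (\sum_(j <- r) B j) (\sum_(j <- r) G j).
Proof.
elim: r => [|j r IH] H; first by exists [::]; rewrite !big_nil.
have [|s [sE sd sB]] := IH; first by move=> i ir; apply: H; rewrite inE ir orbT.
have [t [tE td tB]] := H j (mem_head _ _).
exists (t ++ s); split; first by rewrite big_cons big_cat /= -tE -sE.
  by move=> x; rewrite mem_cat => /orP[/td|/sd].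
by rewrite big_cons big_cat; apply: lerD.
Qed.

Lemma majorized_widen d d' B B' f : (d <= d')%N -> B <= B' ->
  majorized d B f -> majorized d' B' f.
Proof.
move=> dd BB [s [sE sd sB]]; exists s; split=> //; last exact: le_trans BB.
by move=> x /sd /leq_trans; apply.
Qed.

Lemma majorizedM c m d B f : majorized d B f ->
  majorized (mdeg m + d) (normc c * B) (c *: (mpolyX C m * f)).
Proof.
move=> [s [-> sd sB]]; exists [seq (c * x.1, mnm_add m x.2) | x <- s]; split.
- rewrite big_map mulr_sumr scaler_sumr; apply: eq_bigr => x _ /=.
  by rewrite -scalerAr scalerA mpolyXD.
- by move=> _ /mapP[x /sd xd ->] /=; rewrite mdegD leq_add2l.
- rewrite big_map; under eq_bigr do rewrite ComplexField.Normc.normcM.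
  by rewrite -mulr_sumr; apply: ler_wpM2l => //; apply: normc_nonneg.
Qed.

(** The exponents of a monomial of f add up to at most d: hence the factor d, whatever the number of
    variables. *)
Lemma majorized_lie e (X : R) d B f : 0 <= X -> (forall i, majorized e X (xi i)) ->
  majorized d B f -> majorized (d + e) (d%:R * X * B) (lie xi f).
Proof.
move=> X0 xiX [s [-> sd sB]]; rewrite lie_sum.
apply: (@majorized_widen (d + e) _ (\sum_(x <- s) normc x.1 * (d%:R * X))) => //.
  by rewrite -mulr_suml mulrC; apply: ler_wpM2l => //; apply: mulr_ge0.
apply: majorized_sum => x xs; rewrite lieZ /lie scaler_sumr.
apply: (@majorized_widen (d + e) _ (\sum_i normc (x.1 * (x.2 i)%:R) * X)) => //.
  rewrite -mulr_suml mulrA; apply: ler_wpM2r => //.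
  under eq_bigr do rewrite ComplexField.Normc.normcM normc_nat.
  rewrite -mulr_sumr; apply: ler_wpM2l; first exact: normc_nonneg.
  by rewrite -natr_sum -mdegE ler_nat; apply: sd.
apply: majorized_sum => i _; rewrite mderivX.
have -> : x.1 *: (xi i * ((x.2 i)%:R *: mpolyX C (mnm_sub x.2 (mnm1 i)))) =
    (x.1 * (x.2 i)%:R) *: (mpolyX C (mnm_sub x.2 (mnm1 i)) * xi i).
  by rewrite -scalerAr scalerA [xi i * _]mulrC.
apply: majorized_widen (majorizedM _ _ (xiX i)) => //.
by rewrite leq_add2r; apply: leq_trans (mdegB _ _) (sd x xs).
Qed.

(* The degree grows only linearly in k, so the k-th derivative costs k! L^k: this
   is what makes the Lie series converge. *)
Lemma majorized_iter e (X : R) d B f k : 0 <= X -> 0 <= B -> (forall i, majorized e X (xi i)) ->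
  majorized d B f ->
  majorized (d + k * e) (((d + e)%:R * X) ^+ k * k`!%:R * B) (iter k (lie xi) f).
Proof.
move=> X0 B0 xiX fB; elim: k => [|k IH]; first by rewrite addn0 expr0 !mul1r.
apply: majorized_widen (majorized_lie X0 xiX IH); first by rewrite mulSn addnCA addnC.
rewrite exprS factS natrM.
set Y := _ ^+ k; set Z := _`!%:R.
have Y0 : 0 <= Y by apply: exprn_ge0; apply: mulr_ge0.
have -> : (d + e)%:R * X * Y * (k.+1%:R * Z) * B = ((d + e) * k.+1)%:R * X * (Y * Z * B).
  by rewrite natrM; ring.
apply: ler_wpM2r; first by apply: mulr_ge0 => //; apply: mulr_ge0 => //; apply: ler0n.
apply: ler_wpM2r => //; rewrite ler_nat mulnDl; apply: leq_add; first exact: leq_pmulr.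
by rewrite mulnC leq_mul2l leqnSn orbT.
Qed.

Lemma majorized_eval (rho : R) d B f p : 1 <= rho -> (forall i, normc (p 0 i) <= rho) ->
  majorized d B f -> normc (eval f p) <= B * rho ^+ d.
Proof.
move=> rho1 prho [s [-> sd sB]]; have rho0 : 0 <= rho by apply: le_trans rho1.
rewrite /eval raddf_sum; apply: le_trans (normc_sum _ _ _) _.
apply: (@le_trans _ _ (\sum_(x <- s) normc x.1 * rho ^+ d)); last first.
  by rewrite -mulr_suml; apply: ler_wpM2r => //; apply: exprn_ge0.
rewrite big_seq [X in _ <= X]big_seq; apply: ler_sum => x xs /=.
rewrite mevalZ mevalX ComplexField.Normc.normcM; apply: ler_wpM2l; first exact: normc_nonneg.
apply: (@le_trans _ _ (rho ^+ mdeg x.2)); last by apply: ler_weXn2l => //; apply: sd.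
rewrite mdegE -prodrXr -lecR -normr_complex normr_prod rmorph_prod.
apply: ler_prod => i _; rewrite normr_ge0 /= normr_complex lecR normcX.
by apply: lerXn2r => //; rewrite nnegrE ?normc_nonneg.
Qed.

Variable p : 'rV[C]_N.

(** The Taylor coefficients at time 0 that f must have along the integral curve through p. *)
Definition lie_coef f k : C := eval (iter k (lie xi) f) p / k`!%:R.

Lemma lie_coef_lie f k : lie_coef (lie xi f) k = k.+1%:R * lie_coef f k.+1.
Proof.
rewrite /lie_coef -iterSr mulrCA; congr (_ * _).
by rewrite factS natrM invfM mulVKf // pnatr_eq0.
Qed.

Lemma lie_coefD f g k : lie_coef (f + g) k = lie_coef f k + lie_coef g k.
Proof. by rewrite /lie_coef iter_lieD /eval mevalD mulrDl. Qed.

(** Lie series are multiplicative in f; this is what lets their sums be values of f at one point. *)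
Lemma lie_coefM f g k :
  lie_coef (f * g) k = \sum_(j < k.+1) lie_coef f j * lie_coef g (k - j)%N.
Proof.
elim: k f g => [|k IH] f g.
  by rewrite big_ord1 /lie_coef /= /eval mevalM !fact0 !divr1.
have k1 : (k.+1%:R : C) != 0 by rewrite pnatr_eq0.
apply: (mulfI k1); rewrite -lie_coef_lie lieM lie_coefD !IH.
rewrite mulr_sumr.
(* Splitting k+1 as i + (k+1-i) separates the derivative of f from that of g. *)
have -> : \sum_(i < k.+2) k.+1%:R * (lie_coef f i * lie_coef g (k.+1 - i)) =
   \sum_(i < k.+2) i%:R * (lie_coef f i * lie_coef g (k.+1 - i)) +
   \sum_(i < k.+2) (k.+1 - i)%:R * (lie_coef f i * lie_coef g (k.+1 - i)).
  rewrite -big_split; apply: eq_bigr => i _ /=; rewrite -mulrDl -natrD subnKC //.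
  by rewrite -ltnS.
congr (_ + _).
  rewrite [RHS]big_ord_recl mul0r add0r; apply: eq_bigr => i _.
  by rewrite lie_coef_lie /= /bump /= add1n subSS mulrA.
rewrite [RHS]big_ord_recr /= subnn mul0r addr0; apply: eq_bigr => i _.
rewrite lie_coef_lie subSn; last by rewrite -ltnS.
by rewrite mulrCA.
Qed.

Lemma lie_coefC c k : lie_coef (mpolyC N c) k = if k == 0%N then c else 0.
Proof.
case: k => [|k]; first by rewrite /lie_coef /= /eval mevalC fact0 divr1.
rewrite /lie_coef iterSr lieC.
have -> : iter k (lie xi) 0 = 0 by elim: k => //= k ->; rewrite lie0.
by rewrite /eval meval0 mul0r.
Qed.

Lemma lie_coefX_bound : exists2 r : R, 0 < r & forall i, exists B : R, forall n,
  \sum_(k < n) normc (lie_coef (mpolyX C (mnm1 i)) k) * r ^+ k <= B.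
Proof.
have /choice[e0 He] i : exists e, exists B, majorized e B (xi i) by exact: majorized_ex.
have /choice[X0 HX] := He.
pose e := \sum_i e0 i; pose X : R := \sum_i `|X0 i|.
have X_ge0 : 0 <= X by apply: sumr_ge0.
have xiX i : majorized e X (xi i).
  apply: majorized_widen (HX i); first by rewrite /e (bigD1 i) //= leq_addr.
  by apply: le_trans (ler_norm _) _; rewrite /X (bigD1 i) //= lerDl sumr_ge0.
pose rho : R := 1 + \sum_i normc (p 0 i).
have rho1 : 1 <= rho by rewrite lerDl sumr_ge0 // => i _; apply: normc_nonneg.
have rho0 : 0 <= rho by apply: le_trans rho1.
have prho i : normc (p 0 i) <= rho.
  rewrite /rho (bigD1 i) //= addrCA lerDl addr_ge0 //.
  by apply: sumr_ge0 => j _; apply: normc_nonneg.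
(* The k-th coefficient of a coordinate is at most [rho * L ^+ k], the final 1 making L positive. At
   radius 1/(2L) the sums are bounded by a geometric series of sum 2 rho. *)
pose L : R := (1 + e)%:R * X * rho ^+ e + 1.
have L0 : 0 < L by apply: ltr_wpDl => //; apply: mulr_ge0; [apply: mulr_ge0 | apply: exprn_ge0].
exists (2 * L)^-1; first by rewrite invr_gt0 mulr_gt0.
move=> i; exists (rho * 2) => n.
have bk k : normc (lie_coef (mpolyX C (mnm1 i)) k) <= rho * L ^+ k.
  have mX : majorized 1 1 (mpolyX C (mnm1 i)).
    exists [:: (1, mnm1 i)]; split; first by rewrite big_seq1 scale1r.
      by move=> x; rewrite inE => /eqP -> /=; rewrite mdeg1.
    by rewrite big_seq1 ComplexField.Normc.normc1.
  have := majorized_eval rho1 prho (majorized_iter k X_ge0 ler01 xiX mX).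
  rewrite mulr1 exprD expr1 => le.
  have kf : 0 < k`!%:R :> R by rewrite ltr0n fact_gt0.
  have -> : normc (lie_coef (mpolyX C (mnm1 i)) k) =
      normc (eval (iter k (lie xi) (mpolyX C (mnm1 i))) p) / k`!%:R.
    apply: (@complexI R); rewrite -normr_complex normf_div normr_complex normr_nat.
    by rewrite rmorphM fmorphV rmorph_nat.
  rewrite ler_pdivrMr //; apply: le_trans le _.
  have -> : ((1 + e)%:R * X) ^+ k * k`!%:R * (rho * rho ^+ (k * e)) =
     rho * ((1 + e)%:R * X * rho ^+ e) ^+ k * k`!%:R.
    by rewrite mulnC exprM [in RHS]exprMn; ring.
  apply: ler_wpM2r; first exact: ltW.
  apply: ler_wpM2l => //; apply: lerXn2r; rewrite ?nnegrE ?(ltW L0) ?lerDl //.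
  by apply: mulr_ge0; [apply: mulr_ge0 | apply: exprn_ge0].
apply: (@le_trans _ _ (\sum_(k < n) rho * (2^-1) ^+ k)).
  apply: ler_sum => k _.
  rewrite invfM exprMn [X in _ * X]mulrC mulrA; apply: ler_wpM2r.
    by rewrite exprn_ge0 // invr_ge0.
  by rewrite exprVn ler_pdivrMr ?exprn_gt0.
rewrite -mulr_sumr; apply: ler_wpM2l => //.
suff -> : \sum_(k < n) (2^-1 : R) ^+ k = 2 - 2 * 2^-1 ^+ n.
  by rewrite gerBl mulr_ge0 // exprn_ge0 // invr_ge0.
elim: n => [|n IH]; first by rewrite big_ord0 expr0 mulr1 subrr.
by rewrite big_ord_recr /= IH exprS mulrA mulfV ?pnatr_eq0 //; ring.
Qed.

(** [Phi (f, z)] sums the Lie series of f. By multiplicativity it is the value of f at the point phi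
    z whose coordinates are the sums for the variables, and its derivative in z is the sum for
    [lie xi f]. For the variables this is the differential equation. *)
Lemma local_solution : exists2 r : C, 0 < r & exists phi : C -> 'rV[C]_N,
  phi 0 = p /\ forall z, `|z| < r -> solves xi phi z.
Proof.
have [r r0 rX] := lie_coefX_bound; have r_ge0 := ltW r0.
(* The radius found for the coordinates serves every polynomial: only the bound changes under sums
   and products. *)
have sumf f : exists B : R, forall n, \sum_(k < n) normc (lie_coef f k) * r ^+ k <= B.
  elim/mpoly_alg_ind: f => [c|//|f g [A fA] [B gB]|f g [A fA] [B gB]].
  - exists (normc c) => -[|n]; first by rewrite big_ord0 normc_nonneg.
    rewrite big_ord_recl lie_coefC expr0 mulr1 big1 ?addr0 // => i _.
    by rewrite lie_coefC ComplexField.Normc.normc0 mul0r.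
  - exists (A + B) => n; apply: le_trans (lerD (fA n) (gB n)); rewrite -big_split.
    apply: ler_sum => k _ /=; rewrite -mulrDl; apply: ler_wpM2r; first exact: exprn_ge0.
    by rewrite lie_coefD; apply: le_normcD.
  - exists (A * B) => n; under eq_bigr do rewrite lie_coefM.
    by apply: cauchy_product_bound.
pose part f z n := \sum_(k < n) lie_coef f k * z ^+ k.
have /choice[Phi PhiP] (fz : mpoly N C * C) : exists S, normc fz.2 <= r -> clim (part fz.1 fz.2) S.
  case: fz => f z /=; have [zr|] := boolP (normc z <= r); last by exists 0.
  have [B fB] := sumf f.
  have [|S SP] := @complex_summable R (fun k => lie_coef f k * z ^+ k) B.
    move=> n; apply: le_trans (fB n); apply: ler_sum => k _.
    rewrite ComplexField.Normc.normcM normcX; apply: ler_wpM2l; first exact: normc_nonneg.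
    by apply: lerXn2r; rewrite ?nnegrE ?normc_nonneg.
  by exists S.
have half : r / 2 <= r by rewrite ler_pdivrMr // mulr_natr mulr2n lerDl.
pose phi z : 'rV[C]_N := \row_i Phi (mpolyX C (mnm1 i), z).
have PhiE f z : normc z <= r / 2 -> Phi (f, z) = eval f (phi z).
  move=> zr2; have zr := le_trans zr2 half.
  elim/mpoly_alg_ind: f => [c|i|f g IHf IHg|f g IHf IHg].
  - rewrite /eval mevalC; apply: clim_unique (PhiP (_, z) zr) _.
    move=> e e0; exists 1%N => -[//|n] _; rewrite /part big_ord_recl /= lie_coefC expr0 mulr1.
    rewrite big1 ?addr0 ?subrr ?ComplexField.Normc.normc0 ?ltW // => i _.
    by rewrite lie_coefC mul0r.
  - by rewrite /eval mevalXU mxE.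
  - rewrite /eval mevalD -/(eval f _) -/(eval g _) -IHf -IHg.
    apply: clim_unique (PhiP (_, z) zr) _.
    have := climD (PhiP (f, z) zr) (PhiP (g, z) zr); congr (clim _ _).
    apply/funext => n; rewrite /part -big_split; apply: eq_bigr => k _ /=.
    by rewrite lie_coefD mulrDl.
  - rewrite /eval mevalM -/(eval f _) -/(eval g _) -IHf -IHg.
    apply: clim_unique (PhiP (_, z) zr) _.
    apply: clim_near (climM (PhiP (f, z) zr) (PhiP (g, z) zr)) _ => /=.
    have [A fA] := sumf f; have [B gB] := sumf g.
    apply: (@clim_geometric R _ (A * B)) => n.
    have := cauchy_product_partial r_ge0 (fA n) (gB n) zr2.
    congr (normc (_ - _) <= _); apply: eq_bigr => k _; by rewrite lie_coefM.
have Phider f z : normc z < r / 2 ->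
    is_derive (z : C^o) (1 : C^o) ((fun w => Phi (f, w)) : C^o -> C^o) (Phi (lie xi f, z)).
  move=> zr2; apply/(is_derive_eps (K := C)) => e e0.
  have [e' e'0 eE] := pos_real_complex e0.
  have [B gB] := sumf (lie xi (lie xi f)).
  have B0 : 0 <= B by apply: le_trans (gB 0%N); rewrite big_ord0.
  (* The first bound keeps z + h in the disc; the second brings the quadratic remainder |h|^2 B
     below e' |h|. *)
  pose dl := Num.min (r / 2 - normc z) (e' / (B + 1)).
  have B1 : 0 < B + 1 by apply: ltr_wpDl.
  have dl0 : 0 < dl by rewrite lt_min subr_gt0 zr2 divr_gt0.
  exists dl%:C; first by rewrite ltcR.
  move=> h; rewrite normr_complex ltcR lt_min => /andP[hr he].
  have zr : normc z <= r by apply: le_trans half; apply: ltW.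
  have zhr : normc (z + h) <= r.
    apply: le_trans half; apply: le_trans (le_normcD _ _) _; rewrite -lerBrDl; exact: ltW.
  rewrite eE !normr_complex -rmorphM lecR.
  (* With these truncations the terms of degree 0 and 1 cancel and exactly n second-order remainders
     are left. *)
  have lim : clim (fun n => part f (z + h) (n + 2)%N - part f z (n + 2)%N - h * part (lie xi f) z (n + 1)%N)
      (Phi (f, z + h) - Phi (f, z) - h * Phi (lie xi f, z)).
    have c1 := clim_shift 2 (PhiP (f, z + h) zhr).
    have c2 := climZ (-1) (clim_shift 2 (PhiP (f, z) zr)).
    have c3 := climZ (- h) (clim_shift 1 (PhiP (lie xi f, z) zr)).
    have := climD (climD c1 c2) c3; rewrite !mulN1r mulNr; congr (clim _ _).
    by apply/funext => n; rewrite mulN1r mulNr.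
  apply: (@le_trans _ _ (normc h ^+ 2 * B)); last first.
    rewrite expr2 -mulrA [X in _ <= X]mulrC; apply: ler_wpM2l; first exact: normc_nonneg.
    apply: (@le_trans _ _ (normc h * (B + 1))); last by rewrite -ler_pdivlMr // ltW.
    by apply: ler_wpM2l; [exact: normc_nonneg | rewrite lerDl].
  apply: clim_le lim _ => n; rewrite /part.
  have -> : \sum_(k < n + 2) lie_coef f k * (z + h) ^+ k - \sum_(k < n + 2) lie_coef f k * z ^+ k
      - h * (\sum_(k < n + 1) lie_coef (lie xi f) k * z ^+ k) =
    \sum_(k < n) lie_coef f k.+2 * ((z + h) ^+ k.+2 - z ^+ k.+2 - k.+2%:R * h * z ^+ k.+1).
    elim: n => [|n IH].
      rewrite !big_ord_recr !big_ord0 /= lie_coef_lie; ring.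
    rewrite [in RHS]big_ord_recr -IH !addSn ![in LHS]big_ord_recr /=.
    by rewrite addn2 addn1 lie_coef_lie; ring.
  apply: le_trans (normc_sum _ _ _) _.
  apply: (@le_trans _ _ (\sum_(k < n) normc h ^+ 2 * (normc (lie_coef (lie xi (lie xi f)) k) * r ^+ k))).
    apply: ler_sum => k _; rewrite !lie_coef_lie; move: (lie_coef f k.+2) => c.
    rewrite !ComplexField.Normc.normcM !normc_nat.
    have := pow_taylor2 k zr zhr; rewrite natrM => le.
    apply: le_trans (ler_wpM2l (normc_nonneg _) le) _.
    by rewrite le_eqVlt; apply/orP; left; apply/eqP; ring.
  by rewrite -mulr_sumr; apply: ler_wpM2l => //; rewrite exprn_ge0 ?normc_nonneg.
exists (r / 2)%:C; first by rewrite ltcR divr_gt0.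
exists phi; split=> [|z].
  apply/rowP => i; rewrite mxE; have z0 : normc (0 : C) <= r by rewrite ComplexField.Normc.normc0.
  apply: clim_unique (PhiP (_, 0) z0) _ => e e0; exists 1%N => -[//|n] _.
  rewrite /part big_ord_recl expr0 mulr1 big1 => [|k _]; last by rewrite expr0n mulr0.
  by rewrite addr0 /lie_coef /= /eval mevalXU fact0 divr1 subrr ComplexField.Normc.normc0 ltW.
rewrite normr_complex ltcR => zr i.
rewrite (_ : (fun w => phi w 0 i) = (fun w => Phi (mpolyX C (mnm1 i), w))).
  by rewrite -PhiE ?(ltW zr) // -[xi i](lieX xi); apply: Phider.
by apply/funext => w; rewrite mxE.
Qed.
End LieSeries.

(** * Ideals of orbits *)

Section Orbits.
Context (R : realType) (N : nat) (xi : vector_field R[i] N).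
Local Notation C := R[i].

Lemma local_regular_solution p f : eval f p != 0 -> exists2 r : C, 0 < r &
  exists phi : C -> 'rV[C]_N, [/\ phi 0 = p, forall z, `|0 - z| < r -> solves xi phi z &
    forall z, `|0 - z| < r -> eval f (phi z) != 0].
Proof.
move=> fp; have [r r0 [phi [phi0 sol]]] := local_solution xi p.
have sol0 : solves xi phi 0 by apply: sol; rewrite normr0.
have [|r1 r10 r1P] := is_derive_near_neq0 (is_derive_eval f sol0); first by rewrite phi0.
have [c c0 /andP[cr cr1]] := pos_common_lower r0 r10.
exists c => //; exists phi; split=> // z; rewrite sub0r normrN => zc.
  by apply: sol; apply: lt_le_trans zc cr.
by have := r1P z (lt_le_trans zc cr1); rewrite add0r.
Qed.

Lemma orbit_ideal p f : ~ Sing xi p ->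
  (forall q, orbit xi p q -> eval f q = 0) <-> flat xi p f.
Proof.
move=> nsing; split=> [fO|fl q].
  (* A component of xi that stays nonzero keeps the local solution off [Sing xi], so the whole disc
     is one plaque of the orbit. *)
  have [i xip] : exists i, eval (xi i) p != 0.
    apply: contrapT => H; apply: nsing => i; apply/eqP; apply: contrapT => ne.
    by apply: H; exists i; apply/negP.
  have [r r0 [phi [phi0 sol reg]]] := local_regular_solution xip.
  rewrite -phi0; apply: (vanish_flat sol) => [z zr|]; last by rewrite subrr normr0.
  apply: fO; right; split=> //; apply: rt_step.
  exists 0, r, phi; split=> [w wr|].
    split; last exact: sol.
    by move=> sing; have := reg w wr; rewrite sing eqxx.
  exists 0; first by rewrite /ball /= subrr normr0.
  by exists z.
case=> [[/nsing//]|[_ chain]].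
suff /(_ 0%N) : flat xi q f by [].
elim: chain fl => [p' q' [c [r [phi [sol [z zc [w wc [<- <-]]]]]]] fl|//|x y z _ IH1 _ IH2 /IH1/IH2//].
apply: (flat_ball (c := c) (r := r) _ zc wc) fl => u uc.
by have [] := sol u uc.
Qed.

Lemma closure_orbit p q : ~ Sing xi p ->
  zariski_closure (orbit xi p) q <-> forall f, flat xi p f -> eval f q = 0.
Proof.
move=> nsing; split=> H f; last by move=> /(orbit_ideal f nsing)/H.
by move=> /(orbit_ideal f nsing)/H.
Qed.

Lemma closure_orbit_sing p q : Sing xi p -> zariski_closure (orbit xi p) q <-> q = p.
Proof.
move=> sing; split=> [H|-> f fO]; last by apply: fO; left.
apply/rowP => i; apply/eqP; rewrite -subr_eq0.
have := H (mpolyX C (mnm1 i) - mpolyC N (p 0 i)).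
rewrite /eval mevalB mevalXU mevalC => -> // r [[_ ->]|[/(_ sing)//]].
by rewrite mevalB mevalXU mevalC subrr.
Qed.
End Orbits.

(** * Jets of flat polynomials *)

Section MatrixRank.
Variable F : fieldType.

Lemma unit_minor c l (A : 'M[F]_(c, l)) : exists (fr : 'I_(\rank A) -> 'I_c)
  (fc : 'I_(\rank A) -> 'I_l), mxsub fr fc A \in unitmx.
Proof.
pose B := rowsub (maxrankfun A) A.
have fullB : row_full B^T by rewrite /row_full mxrank_tr; exact: maxrowsub_free.
exists (maxrankfun A), (fullrankfun fullB).
rewrite -unitmx_tr; have := fullrowsub_unit fullB; congr (_ \in unitmx).
by apply/matrixP => i j; rewrite !mxE.
Qed.

Lemma rank_le_kernel c l l' (A : 'M[F]_(c, l)) (B : 'M[F]_(c, l')) :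
  (forall v : 'rV_c, v *m B = 0 -> v *m A = 0) -> (\rank A <= \rank B)%N.
Proof.
move=> H; have : (kermx B <= kermx A)%MS.
  apply/rV_subP => v /sub_kermxP vB; apply/sub_kermxP; exact: H.
move/mxrankS; rewrite !mxrank_ker; have := rank_leq_row A; have := rank_leq_row B.
by move=> hB hA; rewrite leq_sub2lE.
Qed.

(** The kernel of A lies in that of [A *m P], and equal ranks make them equal. For P a selection of
    columns: columns of full rank already detect the kernel. *)
Lemma kernel_le_rank c l l' (A : 'M[F]_(c, l)) (P : 'M[F]_(l, l')) (v : 'rV_c) :
  (\rank A <= \rank (A *m P))%N -> v *m (A *m P) = 0 -> v *m A = 0.
Proof.
move=> le vAP; apply/sub_kermxP.
have sub : (kermx A <= kermx (A *m P))%MS by apply/sub_kermxP; rewrite mulmxA mulmx_ker mul0mx.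
have := mxrank_leqif_sup sub; rewrite !mxrank_ker => -[_ e].
apply: (@submx_trans _ _ _ _ _ _ (kermx (A *m P))); first exact/sub_kermxP.
by rewrite -e eqn_leq leq_sub2l ?mxrankM_maxl // leq_sub2l.
Qed.

Lemma rank_mxsub c l c' l' (fr : 'I_c' -> 'I_c) (fc : 'I_l' -> 'I_l) (A : 'M[F]_(c, l)) :
  (\rank (mxsub fr fc A) <= \rank A)%N.
Proof.
have -> : mxsub fr fc A = rowsub fr 1%:M *m (A *m colsub fc 1%:M).
  by rewrite -rowsubE mulmx_colsub mulmx1; apply/matrixP => i j; rewrite !mxE.
exact: leq_trans (mxrankM_maxr _ _) (mxrankM_maxl _ _).
Qed.
End MatrixRank.

Section JetMatrix.
Context (F : fieldType) (M : nat) (zeta : vector_field F M) (D : nat).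

Definition mons (i : 'I_#|{: bmultinom M D}|) : multinom M := bmnm (enum_val i).

Definition poly_of (v : 'rV[F]_#|{: bmultinom M D}|) : mpoly M F :=
  \sum_m v 0 m *: mpolyX F (mons m).

(** [mmeasure mdeg] is the degree plus one, so the hypothesis means degree less than D, as for the
    monomials in [bmultinom M D]. *)
Lemma poly_ofK f : (mmeasure mdeg f <= D)%N -> f = poly_of (\row_m f@_(mons m)).
Proof.
move=> fD; rewrite {1}(mpolywE fD) /poly_of (reindex (@enum_val _ {: bmultinom M D})) /=.
  by apply: eq_bigr => i _; rewrite mxE.
by apply: onW_bij; apply: enum_val_bij.
Qed.

(** A coefficient vector v is sent to the values at x of the first l iterated Lie derivatives; for l
    large the left kernel consists of the flat polynomials of degree less than D. *)
Definition jet l (x : 'rV[F]_M) : 'M[F]_(_, l) :=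
  \matrix_(m, k) eval (iter k (lie zeta) (mpolyX F (mons m))) x.

Lemma mul_jet l x (v : 'rV[F]_#|{: bmultinom M D}|) (k : 'I_l) :
  (v *m jet l x) 0 k = eval (iter k (lie zeta) (poly_of v)) x.
Proof.
rewrite mxE /poly_of iter_lie_sum /eval raddf_sum; apply: eq_bigr => m _ /=.
by rewrite iter_lieZ mevalZ mxE.
Qed.

Lemma flat_jet x v : flat zeta x (poly_of v) <-> forall l, v *m jet l x = 0.
Proof.
split=> [fl l|H k].
  by apply/rowP => k; rewrite mul_jet fl mxE.
by rewrite -(mul_jet x v (@ord_max k)) H mxE.
Qed.

Lemma jet_widen l l' x : (l <= l')%N -> exists P, jet l x = jet l' x *m P.
Proof.
move=> le; exists (\matrix_(k < l', j < l) (k == j :> nat)%:R); apply/matrixP => m j.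
rewrite !mxE (bigD1 (widen_ord le j)) //= !mxE eqxx mulr1 big1 ?addr0 // => i.
by rewrite -val_eqE /= => /negPf ne; rewrite !mxE ne mulr0.
Qed.

Definition jet_stable l x := forall l', (\rank (jet l' x) <= \rank (jet l x))%N.

Lemma jet_stable_ex x : exists l, jet_stable l x.
Proof.
have H : exists r, `[< exists l, \rank (jet l x) = r >].
  by exists (\rank (jet 0 x)); apply/asboolP; exists 0%N.
have bd r : `[< exists l, \rank (jet l x) = r >] -> (r <= #|{: bmultinom M D}|)%N.
  by move=> /asboolP[l <-]; apply: rank_leq_row.
case: (ex_maxnP H bd) => r /asboolP[l lr] rmax; exists l => l'.
by rewrite lr; apply: rmax; apply/asboolP; exists l'.
Qed.

Lemma jet_stable_flat l x v : jet_stable l x -> v *m jet l x = 0 -> flat zeta x (poly_of v).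
Proof.
move=> st v0; apply/flat_jet => l'.
have [P PE] := jet_widen x (leq_maxl l l'); have [Q ->] := jet_widen x (leq_maxr l l').
rewrite mulmxA (@kernel_le_rank _ _ _ _ _ P) ?mul0mx -?PE //.
Qed.

(** More flat polynomials mean smaller rank. The order l' depends on x, since flatness at x is
    visible only once the rank there is stable. *)
Lemma jet_rank_flat x x' : (forall f, flat zeta x f -> flat zeta x' f) ->
  forall l, exists l', (\rank (jet l x') <= \rank (jet l' x))%N.
Proof.
move=> H l; have [l' st] := jet_stable_ex x; exists l'.
by apply: rank_le_kernel => v /(jet_stable_flat st)/H/flat_jet.
Qed.

(** A symmetry of the field preserving degrees acts linearly on coefficient vectors, so one jet
    matrix is a left multiple of the other. *)
Lemma jet_rank_hom (h : {rmorphism mpoly M F -> mpoly M F}) x x' l :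
  (forall f k, h (iter k (lie zeta) f) = iter k (lie zeta) (h f)) ->
  (forall f, eval f x' = eval (h f) x) ->
  (forall m, (mdeg m < D)%N -> (mmeasure mdeg (h (mpolyX F m)) <= D)%N) ->
  (\rank (jet l x') <= \rank (jet l x))%N.
Proof.
move=> hlie hev hdeg.
suff [P ->] : exists P, jet l x' = P *m jet l x by apply: mxrankM_maxr.
exists (\matrix_(m, m') (h (mpolyX F (mons m)))@_(mons m')); apply/matrixP => m k.
have := mul_jet x (\row_m' (h (mpolyX F (mons m)))@_(mons m')) k.
rewrite -poly_ofK; last by apply: hdeg; apply: bmdeg.
rewrite !mxE -hlie -hev => <-; apply: eq_bigr => j _; by rewrite !mxE.
Qed.
End JetMatrix.

(** * Families over K spanning the flat polynomials at every point *)

Section GenericSpan.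
Context (K C : fieldType) (iota : {rmorphism K -> C}) (N M : nat).
Context (zetaK : vector_field K M) (x0 : 'I_M -> mpoly N K) (U : set 'rV[C]_N).

Definition ev (p : 'rV[C]_N) : mpoly N K -> C := mmap iota (fun i => p 0 i).
HB.instance Definition _ p := GRing.RMorphism.on (ev p).

Let zeta : vector_field C M := fun i => map_mpoly iota (zetaK i).

Definition start p : 'rV[C]_M := \row_i ev p (x0 i).

Hypothesis rank_const : forall D l p1 p2, U p1 -> U p2 -> exists l',
  (\rank (jet zeta D l (start p1)) <= \rank (jet zeta D l' (start p2)))%N.

(** Flatness is demanded at every point of U, not generically, so that every specialisation is a
    valid equation. *)
Definition flat_family : set (mpoly M (mpoly N K)) :=
  [set G | forall p, U p -> flat zeta (start p) (map_mpoly (ev p) G)].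

Lemma flat_familyD G H : flat_family G -> flat_family H -> flat_family (G + H).
Proof.
move=> IG IH p Up k.
have -> : map_mpoly (ev p) (G + H) = map_mpoly (ev p) G + map_mpoly (ev p) H by exact: rmorphD.
by rewrite iter_lieD /eval mevalD -!/(eval _ (start p)) (IG p Up k) (IH p Up k) addr0.
Qed.

Lemma flat_familyZ a G : flat_family G -> flat_family (a *: G).
Proof.
move=> IG p Up k; rewrite map_mpolyZ iter_lieZ /eval mevalZ -/(eval _ (start p)).
by rewrite (IG p Up k) mulr0.
Qed.

Lemma flat_familyX m G : flat_family G -> flat_family (mpolyX _ m * G).
Proof.
move=> IG p Up.
have -> : map_mpoly (ev p) (mpolyX _ m * G) = map_mpoly (ev p) (mpolyX _ m) * map_mpoly (ev p) G.
  exact: rmorphM.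
by apply: flatM; apply: IG.
Qed.

Lemma map_lie f k : map_mpoly iota (iter k (lie zetaK) f) = iter k (lie zeta) (map_mpoly iota f).
Proof.
apply: lie_intertwine => [c|i] /=; first by rewrite map_mpolyC lieC.
by rewrite map_mpolyX lieX.
Qed.

Definition start_poly : mpoly M K -> mpoly N K := mmap (@mpolyC N K) x0.
HB.instance Definition _ := GRing.RMorphism.on start_poly.

Lemma ev_start_poly p f : ev p (start_poly f) = eval (map_mpoly iota f) (start p).
Proof.
rewrite /eval meval_map.
apply: (mpoly_rmorph_ext (f := ev p \o start_poly) (g := mmap iota (fun i => start p 0 i))) => [c|i] /=.
  by rewrite /ev /start_poly !mmapC.
by rewrite /start_poly !mmapX !mmap1U mxE.
Qed.

Lemma flat_family_span p f : U p -> flat zeta (start p) f ->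
  exists l (c : 'I_l -> C) (G : 'I_l -> mpoly M (mpoly N K)),
    (forall i, flat_family (G i)) /\ f = \sum_i c i *: map_mpoly (ev p) (G i).
Proof.
move=> Up fl; pose D := mmeasure mdeg f.
have [l0 st] := jet_stable_ex zeta D (start p).
have [fr [fc minor]] := unit_minor (jet zeta D l0 (start p)).
set r := \rank _ in fr fc minor.
pose jetA : 'M[mpoly N K]_(#|{: bmultinom M D}|, l0) :=
  \matrix_(m, k) start_poly (iter k (lie zetaK) (mpolyX K (mons m))).
have jetE p' : map_mx (ev p') jetA = jet zeta D l0 (start p').
  by apply/matrixP => m k; rewrite !mxE ev_start_poly map_lie map_mpolyX.
pose T := colsub fc jetA; pose S := mxsub fr fc jetA; pose d := \det S.
pose Sel : 'M[mpoly N K]_(r, _) := rowsub fr 1%:M.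
have SelT : Sel *m T = S by rewrite -rowsubE -mxsub_comp.
(* Cramer: V annihilates the chosen columns T, and acts as d ^ 2 on their kernel.
   By constancy of the rank, these columns detect flatness wherever d <> 0. *)
pose V := d *: (d%:M - T *m \adj S *m Sel).
have VT : V *m T = 0.
  rewrite -scalemxAl mulmxBl -!mulmxA SelT mul_adj_mx mul_scalar_mx mul_mx_scalar.
  by rewrite subrr scaler0.
have Tp p' : map_mx (ev p') T = jet zeta D l0 (start p') *m colsub fc 1%:M.
  by rewrite map_mxsub jetE mulmx_colsub mulmx1.
have Sp p' : map_mx (ev p') S = mxsub fr fc (jet zeta D l0 (start p')).
  by rewrite map_mxsub jetE.
have dp : ev p d != 0 by rewrite -det_map_mx Sp -unitfE -unitmxE.
pose G m := \sum_m' V m m' *: mpolyX (mpoly N K) (mons m').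
have GE p' m : map_mpoly (ev p') (G m) = poly_of (row m (map_mx (ev p') V)).
  rewrite raddf_sum; apply: eq_bigr => m' _ /=.
  by rewrite map_mpolyZ map_mpolyX !mxE.
have GI m : flat_family (G m).
  (* Where d vanishes the chosen columns may fail to detect flatness; the outer factor d in V makes
     the family zero there. *)
  move=> p' Up'; rewrite GE; have [d0|d0] := eqVneq (ev p' d) 0.
    have -> : row m (map_mx (ev p') V) = 0.
      by apply/rowP => j; rewrite !mxE rmorphM /= d0 mul0r.
    rewrite /poly_of big1 => [k|i _]; last by rewrite mxE scale0r.
    have -> : iter k (lie zeta) 0 = 0 by elim: k => //= k ->; rewrite lie0.
    by rewrite /eval meval0.
  have rT : (r <= \rank (map_mx (ev p') T))%N.
    have : (\rank (map_mx (ev p') S) <= \rank (map_mx (ev p') T))%N.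
      by rewrite -SelT map_mxM; apply: mxrankM_maxr.
    by rewrite mxrank_unit // unitmxE det_map_mx unitfE.
  have rj l : (\rank (jet zeta D l (start p')) <= r)%N.
    have [l' le] := rank_const D l Up' Up; apply: leq_trans le _; exact: st.
  have st' : jet_stable zeta D l0 (start p').
    move=> l; apply: leq_trans (rj l) _; apply: leq_trans rT _.
    by rewrite Tp; apply: mxrankM_maxl.
  apply: (jet_stable_flat st'); apply: (@kernel_le_rank _ _ _ _ _ (colsub fc 1%:M)).
    by rewrite -Tp; apply: leq_trans (rj l0) rT.
  by rewrite -Tp -row_mul -map_mxM VT map_mx0 row0.
pose v : 'rV[C]_#|{: bmultinom M D}| := \row_m f@_(mons m).
have fv : f = poly_of v by apply: poly_ofK.
exists _, (fun m => v 0 m / ev p d ^+ 2), G; split=> //.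
have vV : v *m map_mx (ev p) V = ev p d ^+ 2 *: v.
  rewrite map_mxZ map_mxB map_scalar_mx !map_mxM -scalemxAr mulmxBr !mulmxA Tp mulmxA.
  have -> : v *m jet zeta D l0 (start p) = 0 by move: fl; rewrite fv => /flat_jet.
  by rewrite !mul0mx subr0 mul_mx_scalar scalerA expr2.
have vE j : v 0 j = \sum_m v 0 m / ev p d ^+ 2 * (map_mx (ev p) V) m j.
  have := congr1 (fun w : 'rV[C]_ _ => w 0 j / ev p d ^+ 2) vV.
  rewrite !mxE mulrAC divff ?expf_neq0 // mul1r => <-.
  rewrite mulr_suml; apply: eq_bigr => m _; by rewrite !mxE mulrAC.
rewrite fv {1}/poly_of; under eq_bigr => j _ do rewrite vE scaler_suml.
rewrite exchange_big; apply: eq_bigr => m _ /=; rewrite GE /poly_of scaler_sumr.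
by apply: eq_bigr => j _; rewrite scalerA !mxE.
Qed.
End GenericSpan.

(** * The system of frames *)

Section FrameSystem.
Context (F : fieldType) (n : nat).
Local Notation N := (1 + n)%N.
Local Notation M := (N + n * n)%N.

Definition lift_poly : mpoly N F -> mpoly M F :=
  mmap (@mpolyC M F) (fun i => mpolyX F (mnm1 (lshift (n * n) i))).
HB.instance Definition _ := GRing.RMorphism.on lift_poly.

Lemma lift_polyC c : lift_poly (mpolyC N c) = mpolyC M c.
Proof. by rewrite /lift_poly mmapC. Qed.

Lemma lift_polyX i : lift_poly (mpolyX F (mnm1 i)) = mpolyX F (mnm1 (lshift (n * n) i)).
Proof. by rewrite /lift_poly mmapX mmap1U. Qed.

Lemma eval_lift f (x : 'rV[F]_M) : eval (lift_poly f) x = eval f (lsubmx x).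
Proof.
rewrite /eval; apply: (mpoly_rmorph_ext (f := meval (fun i => x 0 i) \o lift_poly)
  (g := meval (fun i => lsubmx x 0 i))) => [c|i] /=.
  by rewrite lift_polyC !mevalC.
by rewrite lift_polyX !mevalXU mxE.
Qed.

Definition tvar : 'I_N := lshift n 0.

Lemma rmorph_in_t (B : comNzRingType) (h : {rmorphism mpoly N F -> B}) p :
  h (in_t n p) = (map_poly (h \o @mpolyC N F) p).[h (mpolyX F (mnm1 tvar))].
Proof. by rewrite /in_t -horner_map /= -map_poly_comp. Qed.

Lemma eval_in_t (p : {poly F}) (x : 'rV[F]_N) : eval (in_t n p) x = p.[x 0 tvar].
Proof.
rewrite /eval rmorph_in_t /= mevalXU; congr (_.[_]).
by apply: map_poly_id => c _ /=; rewrite mevalC.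
Qed.

(* The unknown frame: a fundamental matrix of the linear system, whose entries are
   extra coordinates appended to (t, y). *)
Definition frame : 'M[mpoly M F]_n := vec_mx (\row_e mpolyX F (mnm1 (rshift N e))).

Definition coef_mx (A : 'M[{poly F}]_n) : 'M[mpoly M F]_n := map_mx (lift_poly \o @in_t F n) A.

Definition frame_vf (q : {poly F}) (A : 'M[{poly F}]_n) : vector_field F M := fun k =>
  match fintype.split k with
  | inl i => lift_poly (system_vf q A i)
  | inr e => mxvec (coef_mx A *m frame) 0 e
  end.

Context (q : {poly F}) (A : 'M[{poly F}]_n).
Local Notation zeta := (frame_vf q A).
Local Notation xi := (system_vf q A).

Lemma frame_vf_l i : zeta (lshift _ i) = lift_poly (xi i).
Proof. by rewrite /frame_vf (unsplitK (inl i)). Qed.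

Lemma frame_vf_r e : zeta (rshift _ e) = mxvec (coef_mx A *m frame) 0 e.
Proof. by rewrite /frame_vf (unsplitK (inr e)). Qed.

Lemma lie_lift f k : lift_poly (iter k (lie xi) f) = iter k (lie zeta) (lift_poly f).
Proof.
apply: lie_intertwine => [c|i] /=; first by rewrite lift_polyC lieC.
by rewrite lift_polyX lieX frame_vf_l.
Qed.

Lemma lie_frame : map_mx (lie zeta) frame = coef_mx A *m frame.
Proof.
apply/matrixP => a b; rewrite mxE !mxE lieX frame_vf_r mxvecE.
by rewrite mxE.
Qed.

Definition act_var (v : 'cV[F]_n) (h : 'M[F]_n) (k : 'I_M) : mpoly M F :=
  match fintype.split k with
  | inl i => lift_poly (mpolyX F (mnm1 i)) + match fintype.split i with
             | inl _ => 0
             | inr j => (frame *m map_mx (@mpolyC M F) v) j 0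
             end
  | inr e => mxvec (frame *m map_mx (@mpolyC M F) h) 0 e
  end.

(* Changes of the initial frame and translations of y by solutions commute with
   the flow. *)
Definition act v h : mpoly M F -> mpoly M F := mmap (@mpolyC M F) (act_var v h).
HB.instance Definition _ v h := GRing.RMorphism.on (act v h).

Lemma actC v h c : act v h (mpolyC M c) = mpolyC M c.
Proof. by rewrite /act mmapC. Qed.

Lemma actX v h k : act v h (mpolyX F (mnm1 k)) = act_var v h k.
Proof. by rewrite /act mmapX mmap1U. Qed.

Lemma act_t v h p : act v h (lift_poly (in_t n p)) = lift_poly (in_t n p).
Proof.
have /= -> := rmorph_in_t (act v h \o lift_poly) p; have /= -> := rmorph_in_t lift_poly p.
congr (_.[_]).
  by apply: eq_map_poly => c /=; rewrite lift_polyC actC.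
rewrite lift_polyX actX /act_var (unsplitK (inl _)) /= (unsplitK (inl _)) addr0.
by rewrite lift_polyX.
Qed.

Lemma act_frame v h : map_mx (act v h) frame = frame *m map_mx (@mpolyC M F) h.
Proof.
apply/matrixP => a b; rewrite mxE [frame a b]mxE mxE actX /act_var (unsplitK (inr _)) /=.
by rewrite mxvecE.
Qed.

Lemma act_coef v h : map_mx (act v h) (coef_mx A) = coef_mx A.
Proof. by apply/matrixP => a b; rewrite !mxE act_t. Qed.

Lemma lie_mulmx_const l (H : 'M[F]_(n, l)) a b :
  lie zeta ((frame *m map_mx (@mpolyC M F) H) a b) =
    (coef_mx A *m (frame *m map_mx (@mpolyC M F) H)) a b.
Proof.
rewrite mulmxA -lie_frame [in LHS]mxE lie_sum [in RHS]mxE; apply: eq_bigr => c _.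
by rewrite lieM [map_mx _ H c b]mxE lieC mulr0 addr0 [map_mx _ _ a c]mxE.
Qed.

(** The coefficients depend only on t, which is fixed, and g v and g h solve the same linear
    equation as y and g. *)
Lemma act_lie v h f k : act v h (iter k (lie zeta) f) = iter k (lie zeta) (act v h f).
Proof.
apply: lie_intertwine => [c|k'] /=; first by rewrite actC lieC.
rewrite actX -(splitK k'); case: (fintype.split k') => [i|e] /=.
  have := lie_lift (mpolyX F (mnm1 i)) 1; rewrite /= lieX => lieXi.
  rewrite /act_var (unsplitK (inl _)) lieD frame_vf_l -lieXi.
  rewrite -(splitK i); case: (fintype.split i) => [t0|j] /=.
    by rewrite (unsplitK (inl _)) lie0 addr0 /system_vf (unsplitK (inl _)) act_t.
  rewrite (unsplitK (inr _)) lie_mulmx_const /system_vf (unsplitK (inr _)).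
  rewrite !rmorph_sum [X in _ + X]mxE -big_split; apply: eq_bigr => c _ /=.
  rewrite !rmorphM /= act_t [coef_mx A j c]mxE -mulrDr; congr (_ * _).
  by rewrite lift_polyX actX /act_var (unsplitK (inl _)) (unsplitK (inr _)) lift_polyX.
rewrite /act_var (unsplitK (inr _)) frame_vf_r.
case/mxvec_indexP: e => a b; rewrite !mxvecE lie_mulmx_const.
have -> : act v h ((coef_mx A *m frame) a b) = (map_mx (act v h) (coef_mx A *m frame)) a b.
  by rewrite [RHS]mxE.
by rewrite map_mxM act_coef act_frame.
Qed.

Definition act_pt v h (x : 'rV[F]_M) : 'rV[F]_M := \row_k eval (act_var v h k) x.

Lemma eval_act v h f x : eval (act v h f) x = eval f (act_pt v h x).
Proof.
rewrite /eval; apply: (mpoly_rmorph_ext (f := meval (fun i => x 0 i) \o act v h)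
  (g := meval (fun i => act_pt v h x 0 i))) => [c|i] /=.
  by rewrite actC !mevalC.
by rewrite actX mevalXU mxE.
Qed.

(** The bound 2 means degree at most 1: v and h being constant, the substitution is affine and
    preserves the degree bound D of the jets. *)
Lemma act_var_degree v h k : (mmeasure mdeg (act_var v h k) <= 2)%N.
Proof.
have X2 i : (mmeasure mdeg (mpolyX F (mnm1 i) : mpoly M F) <= 2)%N.
  by rewrite mmeasureX /= mdeg1.
have lin l (H : 'M[F]_(n, l)) i j :
    (mmeasure mdeg ((frame *m map_mx (@mpolyC M F) H) i j) <= 2)%N.
  rewrite mxE; apply: leq_trans (mmeasure_sum _ _ _ _) _; apply/bigmax_leqP => c _.
  rewrite !mxE mulrC mul_mpolyC; exact: leq_trans (mmeasureZ_le _ _ _) (X2 _).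
rewrite /act_var; case: (fintype.split k) => [i|e]; last first.
  by case/mxvec_indexP: e => a b; rewrite mxvecE.
apply: leq_trans (mmeasureD_le _ _ _) _; rewrite geq_max lift_polyX X2.
by case: (fintype.split i) => [_|j]; [rewrite mmeasure0 | exact: lin].
Qed.

Lemma act_degree v h D m : (mdeg m < D)%N -> (mmeasure mdeg (act v h (mpolyX F m)) <= D)%N.
Proof.
move=> mD; apply: leq_trans mD; rewrite /act mmapX /mmap1 mdegE.
have mulD d e (f g : mpoly M F) : (mmeasure mdeg f <= d.+1)%N -> (mmeasure mdeg g <= e.+1)%N ->
    (mmeasure mdeg (f * g) <= (d + e).+1)%N.
  move=> fd ge; have [->|f0] := eqVneq f 0; first by rewrite mul0r mmeasure0.
  have [->|g0] := eqVneq g 0; first by rewrite mulr0 mmeasure0.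
  by rewrite msizeM // -ltnS prednK ?addn_gt0 ?lt0n ?mmeasure_poly_eq0 ?f0 //
    (leq_trans (leq_add fd ge)) // addSn addnS.
apply: (big_ind2 (fun (f : mpoly M F) d => (mmeasure mdeg f <= d.+1)%N)) => [|f d g e|k _].
- by rewrite mmeasure1.
- exact: mulD.
elim: (m k) => [|j IH]; first by rewrite expr0 mmeasure1.
by rewrite exprS; apply: (mulD 1%N j) => //; apply: act_var_degree.
Qed.
End FrameSystem.

Lemma lie_in_t (F : fieldType) n (q : {poly F}) (A : 'M[{poly F}]_n) (b : {poly F}) :
  lie (system_vf q A) (in_t n b) = in_t n (deriv b) * in_t n q.
Proof.
have in_tE (a : {poly F}) c : in_t n (a * 'X + c%:P) = in_t n a * mpolyX F (mnm1 (tvar n)) + mpolyC _ c.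
  by rewrite /in_t rmorphD rmorphM /= map_polyX map_polyC hornerD hornerM hornerX hornerC.
have in_tD (a c : {poly F}) : in_t n (a + c) = in_t n a + in_t n c.
  by rewrite /in_t rmorphD hornerD.
have in_tX (a : {poly F}) : in_t n (a * 'X) = in_t n a * mpolyX F (mnm1 (tvar n)).
  by rewrite -[a * 'X]addr0 -(polyC0 F) in_tE mpolyC0 addr0.
elim/poly_ind: b => [|b c IH].
  by rewrite linear0 /in_t !rmorph0 !horner0 mul0r lie0.
rewrite in_tE lieD lieC addr0 lieM IH lieX /system_vf (unsplitK (inl _)).
rewrite derivD derivC addr0 derivM derivX mulr1 in_tD in_tX mulrDl.
by congr (_ + _); exact: mulrAC.
Qed.

Section FrameMap.
Context (F G : fieldType) (iota : {rmorphism F -> G}) (n : nat).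
Context (q : {poly F}) (A : 'M[{poly F}]_n).
Local Notation N := (1 + n)%N.
Local Notation M := (N + n * n)%N.
Local Notation AG := (map_mx (map_poly iota) A).
Local Notation qG := (map_poly iota q).

Lemma map_in_t (p : {poly F}) : map_mpoly iota (in_t n p) = in_t n (map_poly iota p).
Proof.
have /= -> := rmorph_in_t (map_mpoly iota) p; rewrite map_mpolyX /in_t -map_poly_comp.
by congr (_.[_]); apply: eq_map_poly => c /=; rewrite map_mpolyC.
Qed.

Lemma map_system_vf i : map_mpoly iota (system_vf q A i) = system_vf qG AG i.
Proof.
rewrite /system_vf; case: (fintype.split i) => [_|j]; first exact: map_in_t.
by rewrite rmorph_sum; apply: eq_bigr => k _; rewrite rmorphM /= map_in_t map_mpolyX mxE.
Qed.

Lemma map_lift (f : mpoly N F) : map_mpoly iota (lift_poly f) = lift_poly (map_mpoly iota f).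
Proof.
apply: (mpoly_rmorph_ext (f := map_mpoly iota \o @lift_poly F n)
  (g := @lift_poly G n \o map_mpoly iota)) => [c|i] /=.
  by rewrite lift_polyC !map_mpolyC lift_polyC.
by rewrite lift_polyX !map_mpolyX lift_polyX.
Qed.

Lemma map_frame_vf k : map_mpoly iota (frame_vf q A k) = frame_vf qG AG k.
Proof.
rewrite -(splitK k); case: (fintype.split k) => [i|e] /=.
  by rewrite !frame_vf_l map_lift map_system_vf.
rewrite !frame_vf_r; case/mxvec_indexP: e => a b; rewrite !mxvecE !mxE rmorph_sum.
apply: eq_bigr => c _; rewrite rmorphM /= !mxE map_mpolyX; congr (_ * _).
by rewrite map_lift map_in_t.
Qed.
End FrameMap.

(** * Constancy of the jet rank over the regular points *)

Section RankConst.
Context (R : realType) (K : fieldType) (iota : {rmorphism K -> R[i]}) (n : nat).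
Context (q : {poly K}) (A : 'M[{poly K}]_n).
Local Notation C := R[i].
Local Notation N := (1 + n)%N.
Local Notation M := (N + n * n)%N.
Local Notation qC := (map_poly iota q).
Local Notation AC := (map_mx (map_poly iota) A).
Local Notation zeta := (frame_vf qC AC).

(** If b(t) vanishes along the curve, so does its Lie derivative q b', hence b' since q does not
    vanish. By induction b' = 0, so b is a constant that vanishes. *)
Lemma poly_along_curve (phi : C -> 'rV[C]_M) (r : C) (b : {poly C}) : 0 < r ->
  (forall z, `|0 - z| < r -> solves zeta phi z) ->
  (forall z, `|0 - z| < r -> qC.[lsubmx (phi z) 0 (tvar n)] != 0) ->
  (forall z, `|0 - z| < r -> b.[lsubmx (phi z) 0 (tvar n)] = 0) -> b = 0.
Proof.
move=> r0 sol qn0; have [k le] := ubnP (size b); elim: k b le => // k IH b le bz.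
have z0 : `|0 - 0 : C| < r by rewrite subrr normr0.
have db0 : (deriv b) = 0.
  have [->|bn0] := eqVneq b 0; first exact: linear0.
  apply: IH => [|z zr]; first exact: leq_trans (lt_size_deriv bn0) le.
  have fl : flat zeta (phi z) (lift_poly (in_t n b)).
    by apply: (vanish_flat sol) zr => w wr; rewrite eval_lift eval_in_t bz.
  have /eqP := fl 1%N.
  rewrite -lie_lift eval_lift /= lie_in_t /eval mevalM -!/(eval _ _) !eval_in_t.
  by rewrite mulf_eq0 (negPf (qn0 z zr)) orbF => /eqP.
have bC : b = (b`_0)%:P.
  apply/polyP => -[|i]; rewrite coefC //=.
  have /eqP := congr1 (fun p : {poly C} => p`_i) db0; rewrite coef_deriv coef0.
  by rewrite -mulr_natr mulf_eq0 pnatr_eq0 orbF => /eqP.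
by have := bz 0 z0; rewrite bC hornerC => ->.
Qed.

Definition frame_start (k : 'I_M) : mpoly N K :=
  match fintype.split k with
  | inl i => mpolyX K (mnm1 i)
  | inr e => mpolyC N (mxvec 1%:M 0 e)
  end.

Lemma frame_startE (p : 'rV[C]_N) : start iota frame_start p = row_mx p (mxvec 1%:M).
Proof.
apply/rowP => k; rewrite mxE /frame_start mxE; case: (fintype.split k) => [i|e].
  by rewrite /ev mmapX mmap1U.
rewrite /ev mmapC; case/mxvec_indexP: e => a b; rewrite !mxvecE !mxE.
by case: (a == b); [exact: (rmorph1 iota) | exact: (rmorph0 iota)].
Qed.

(** Over a given t, every point with invertible frame can be moved to every starting point. *)
Lemma act_pt_start (x : 'rV[C]_M) (p : 'rV[C]_N) : vec_mx (rsubmx x) \in unitmx ->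
  lsubmx x 0 (tvar n) = p 0 (tvar n) ->
  exists v h, act_pt v h x = start iota frame_start p.
Proof.
(* The frame part asks for g h = 1, and g v must be the difference of the two y-parts. *)
set g := vec_mx _ => gu xt; pose h := invmx g.
pose v := h *m (rsubmx (p : 'rV_(1 + n)) - rsubmx (lsubmx x))^T.
have evf (l : nat) (H : 'M[C]_(n, l)) i j :
    eval ((@frame C n *m map_mx (@mpolyC M C) H) i j) x = (g *m H) i j.
  rewrite !mxE /eval rmorph_sum; apply: eq_bigr => c _ /=.
  by rewrite mevalM !mxE mevalXU mevalC.
exists v, h; rewrite frame_startE; apply/rowP => k; rewrite mxE /act_var [RHS]mxE.
case: (fintype.split k) => [i|e]; last first.
  by case/mxvec_indexP: e => a b; rewrite !mxvecE evf mulmxV.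
rewrite /eval mevalD -!/(eval _ _) eval_lift {1}/eval mevalXU.
rewrite -(splitK i); case: (fintype.split i) => [t0|j].
  by rewrite /= (unsplitK (inl _)) /eval meval0 addr0 (ord1 t0) xt.
by rewrite /= (unsplitK (inr _)) evf mulKVmx // !mxE addrCA subrr addr0.
Qed.

(** A local solution over p2 need not reach the t of p1. Instead, a maximal minor that is nonzero
    over p1 is followed as a polynomial in t alone: the curve from p2 meets some s where it is
    nonzero. The rank over p1 is then at most that over [at_t s], hence, by symmetry, at most that
    at the point x of the curve, hence, by flow invariance of flatness, at most a rank over p2. *)
Lemma frame_rank_const D l (p1 p2 : 'rV[C]_N) : qC.[p1 0 (tvar n)] != 0 -> qC.[p2 0 (tvar n)] != 0 ->
  exists l', (\rank (jet zeta D l (start iota frame_start p1)) <=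
              \rank (jet zeta D l' (start iota frame_start p2)))%N.
Proof.
move=> q1 q2.
have [fr [fc minor]] := unit_minor (jet zeta D l (start iota frame_start p1)).
set r := \rank _ in fr fc minor *.
pose jetA : 'M[mpoly N K]_(r, r) := \matrix_(i, j)
  start_poly frame_start (iter (fc j) (lie (frame_vf q A)) (mpolyX K (@mons M D (fr i)))).
have jetE p : map_mx (ev iota p) jetA = mxsub fr fc (jet zeta D l (start iota frame_start p)).
  apply/matrixP => i j; rewrite !mxE ev_start_poly map_lie map_mpolyX.
  by rewrite (_ : (fun i => _) = zeta) //; apply/funext => k; rewrite map_frame_vf.
pose d := \det jetA.
have dE p : \det (mxsub fr fc (jet zeta D l (start iota frame_start p))) = ev iota p d.
  by rewrite -jetE; exact: det_map_mx.
pose at_t s : 'rV[C]_N := \row_i if i == tvar n then s else p1 0 i.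
(* The minor restricted to the line through p1 along which only t varies. *)
pose b : {poly C} := mmap (polyC \o iota) (fun i => if i == tvar n then 'X else (p1 0 i)%:P) d.
have bE s : b.[s] = ev iota (at_t s) d.
  apply: (mpoly_rmorph_ext (f := horner_eval s \o mmap (polyC \o iota) _)
    (g := ev iota (at_t s))) => [c|i] /=.
    by rewrite /ev !mmapC /horner_eval /= hornerC.
  rewrite /ev !mmapX !mmap1U mxE /horner_eval.
  by case: ifP => _; rewrite ?hornerX ?hornerC.
have at_p1 : at_t (p1 0 (tvar n)) = p1.
  by apply/rowP => i; rewrite mxE; case: eqP => [->|].
have bn0 : b != 0.
  apply: contraTneq minor => b0; rewrite unitmxE unitfE dE.
  by rewrite -at_p1 -bE b0 horner0 eqxx.
(* Staying nonzero along the curve, f keeps the frame invertible and q(t) nonzero at once. *)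
pose f : mpoly M C := \det (@frame C n) * lift_poly (in_t n qC).
have fE (x : 'rV[C]_M) : eval f x = \det (vec_mx (rsubmx x)) * qC.[lsubmx x 0 (tvar n)].
  rewrite /f /eval mevalM -!/(eval _ _) eval_lift eval_in_t; congr (_ * _).
  rewrite /eval -det_map_mx; congr (\det _); apply/matrixP => i j.
  by rewrite !mxE /= mevalXU.
have f0 : eval f (start iota frame_start p2) != 0.
  rewrite fE frame_startE row_mxKl row_mxKr mxvecK det1 mul1r //.
have [rr rr0 [phi [phi0 sol reg]]] := local_regular_solution zeta f0.
have [z zr bz] : exists2 z, `|0 - z| < rr & b.[lsubmx (phi z) 0 (tvar n)] != 0.
  apply: contrapT => H; move/eqP: bn0; apply; apply: (poly_along_curve rr0 sol) => z zr.
    by have := reg z zr; rewrite fE mulf_eq0 negb_or => /andP[].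
  by apply/eqP; apply: contrapT => /negP bz; apply: H; exists z.
set x := phi z in bz; have := reg z zr; rewrite fE -/x mulf_eq0 negb_or => /andP[gu _].
pose s := lsubmx x 0 (tvar n).
have [v [h xE]] : exists v h, act_pt v h x = start iota frame_start (at_t s).
  by apply: act_pt_start; [rewrite unitmxE unitfE | rewrite [RHS]mxE eqxx].
have le1 : (r <= \rank (jet zeta D l (start iota frame_start (at_t s))))%N.
  have u : mxsub fr fc (jet zeta D l (start iota frame_start (at_t s))) \in unitmx.
    by rewrite unitmxE unitfE dE -bE.
  by rewrite -{1}(mxrank_unit u); apply: rank_mxsub.
have le2 : (\rank (jet zeta D l (act_pt v h x)) <= \rank (jet zeta D l x))%N.
  apply: (jet_rank_hom (h := act v h)) => [g k|g|m mD].
  - exact: act_lie.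
  - by rewrite eval_act.
  - exact: act_degree.
have [l' le3] : exists l', (\rank (jet zeta D l x) <= \rank (jet zeta D l' (phi 0%R)))%N.
  apply: jet_rank_flat => g; apply: (flat_ball sol) => //; by rewrite subrr normr0.
exists l'; rewrite -phi0; apply: leq_trans le3; apply: leq_trans le2.
by rewrite xE.
Qed.
End RankConst.

(** * Constructibility *)

(** At a pole of A this is part of the hypothesis; elsewhere the entries are q times functions
    regular at t. *)
Lemma clears_poles_root (K C : fieldType) (iota : {rmorphism K -> C}) n
    (A : 'M[{fraction {poly K}}]_n) (q : {poly K}) (At : 'M[{poly K}]_n) (t : C) :
  clears_poles iota A q At -> (map_poly iota q).[t] = 0 ->
  forall i j, (map_poly iota (At i j)).[t] = 0.
Proof.
move=> [q0 AtE Atpole] qt i j.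
have [/Atpole/(_ i j)//|npole] := pselect (pole iota A t).
have [a [b [Aab bt]]] : regular_at iota (A i j) t.
  by apply: contrapT => nreg; apply: npole; exists i, j.
have b0 : tofrac b != 0.
  by rewrite tofrac_eq0; apply: contraNneq bt => ->; rewrite rmorph0 horner0.
have : tofrac (At i j) * tofrac b = tofrac q * tofrac a by rewrite AtE Aab mulrA divfK.
rewrite -!tofracM => /eqP; rewrite tofrac_eq => /eqP E.
have := congr1 (fun p => (map_poly iota p).[t]) E.
by rewrite !rmorphM !hornerM qt mul0r => /eqP; rewrite mulf_eq0 (negPf bt) orbF => /eqP.
Qed.

Section Constructible.
Context (K C : fieldType) (iota : {rmorphism K -> C}) (N : nat).

Lemma constructible0 : constructible_over iota (set0 : set 'rV[C]_N).
Proof. by exists [::]; apply/seteqP; split=> // p [FG]. Qed.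

Lemma constructibleU (S T : set 'rV[C]_N) : constructible_over iota S ->
  constructible_over iota T -> constructible_over iota (S `|` T).
Proof.
move=> [s ->] [t ->]; exists (s ++ t); apply/seteqP; split=> p.
  by case=> -[FG FGs H]; exists FG => //; rewrite mem_cat FGs ?orbT.
by case=> FG; rewrite mem_cat => /orP[] FGs H; [left | right]; exists FG.
Qed.

Lemma constructible_piece (fs gs : seq (mpoly N K)) :
  constructible_over iota (zero_set iota fs `\` zero_set iota gs).
Proof.
exists [:: (fs, gs)]; apply/seteqP; split=> p.
  by move=> [? ?]; exists (fs, gs) => //; rewrite inE.
by case=> FG; rewrite inE => /eqP -> /= [].
Qed.
End Constructible.

Definition adjoin (A : comNzRingType) (J : set A) (a : A) : set A :=
  [set x | exists c d, J c /\ x = c + d * a].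

Lemma adjoin_ideal (A : comNzRingType) (J : set A) a : is_ideal J -> is_ideal (adjoin J a).
Proof.
move=> [J0 JD JM]; split=> [|_ _ [c [d [Jc ->]]] [c' [d' [Jc' ->]]]|x _ [c [d [Jc ->]]]].
- by exists 0, 0; rewrite mul0r addr0.
- by exists (c + c'), (d + d'); split; [exact: JD | ring].
- by exists (x * c), (x * d); split; [exact: JM | ring].
Qed.

Lemma sub_adjoin (A : comNzRingType) (J : set A) a : J `<=` adjoin J a.
Proof. by move=> c Jc; exists c, 0; rewrite mul0r addr0. Qed.

Lemma mem_adjoin (A : comNzRingType) (J : set A) a : is_ideal J -> adjoin J a a.
Proof. by move=> [J0 _ _]; exists 0, 1; rewrite mul1r add0r. Qed.

Section Lifted.
Context (F : fieldType) (n : nat).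
Local Notation N := (1 + n)%N.
Local Notation M := (N + n * n)%N.

Definition frame_var (k : 'I_M) : bool := if fintype.split k is inr _ then true else false.

Lemma wdeg_lift (f : mpoly N F) m : wdeg frame_var m != 0%N -> (lift_poly f)@_m = 0.
Proof.
elim/mpoly_alg_ind: f m => [c|i|f g IHf IHg|f g IHf IHg] m m0.
- rewrite lift_polyC mcoeffC; case: eqP => [e|_]; last by rewrite mulr0.
  by move: m0; rewrite e /wdeg big1 // => i _; rewrite mnm0E.
- rewrite lift_polyX mcoeffX; case: eqP => [e|//].
  move: m0; rewrite -e /wdeg big1 // => k; rewrite mnm1E /frame_var.
  by case: eqP => // <-; rewrite (unsplitK (inl _)).
- by rewrite rmorphD mcoeffD IHf // IHg // addr0.
rewrite rmorphM mcoeffM big1 // => k /eqP mk.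
have := m0; rewrite [in wdeg _ m]mk wdegD addn_eq0 negb_and => /orP[/IHf ->|/IHg ->].
  by rewrite mul0r.
by rewrite mulr0.
Qed.

Definition unlift_poly : mpoly M F -> mpoly N F :=
  mmap (@mpolyC N F) (fun k => if fintype.split k is inl i then mpolyX F (mnm1 i) else 0).
HB.instance Definition _ := GRing.RMorphism.on unlift_poly.

Lemma unlift_polyX k : unlift_poly (mpolyX F (mnm1 k)) =
  if fintype.split k is inl i then mpolyX F (mnm1 i) else 0.
Proof. by rewrite /unlift_poly mmapX mmap1U. Qed.

Lemma unliftK (g : mpoly M F) : (forall m, wdeg frame_var m != 0%N -> g@_m = 0) ->
  lift_poly (unlift_poly g) = g.
Proof.
move=> g0; transitivity (\sum_(m <- msupp g) lift_poly (unlift_poly (g@_m *: mpolyX F m))).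
  by rewrite -(rmorph_sum (@lift_poly F n)) -(rmorph_sum unlift_poly) -mpolyE.
rewrite [RHS](mpolyE g); apply: eq_big_seq => m mg.
have m0 : wdeg frame_var m = 0%N.
  by apply/eqP; apply: contraTT mg => /g0 m0; rewrite mcoeff_msupp m0 eqxx.
rewrite -!mul_mpolyC !rmorphM /=; congr (_ * _).
  by rewrite /unlift_poly mmapC lift_polyC.
rewrite mpolyXE_id !rmorph_prod; apply: eq_bigr => k _ /=.
rewrite !rmorphXn /= unlift_polyX; have := splitK k.
have := @sum_nat_eq0 _ frame_var m; rewrite -/(wdeg _ _) m0 eqxx.
move=> /esym/forallP/(_ k); rewrite {1}/frame_var.
case: (fintype.split k) => [i|e] /= => [_ <-|/eqP -> _]; first by rewrite lift_polyX.
by rewrite !expr0.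
Qed.

Lemma eval_unlift (g : mpoly M F) (y : 'rV[F]_N) :
  eval (unlift_poly g) y = eval g (row_mx y 0).
Proof.
rewrite /eval; apply: (mpoly_rmorph_ext (f := meval (fun i => y 0 i) \o unlift_poly)
  (g := meval (fun k => row_mx y 0 0 k))) => [c|k] /=.
  by rewrite /unlift_poly mmapC !mevalC.
rewrite unlift_polyX mevalXU mxE; case: (fintype.split k) => [i|e].
  by rewrite mevalXU.
by rewrite meval0 mxE.
Qed.
End Lifted.

(** * Equations over K for the orbit closures *)

Section OrbitClosure.
Context (R : realType) (K : fieldType) (iota : {rmorphism K -> R[i]}) (n : nat).
Context (q : {poly K}) (At : 'M[{poly K}]_n).
Local Notation C := R[i].
Local Notation N := (1 + n)%N.
Local Notation M := (N + n * n)%N.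
Local Notation qC := (map_poly iota q).
Local Notation xi := (fun i => map_mpoly iota (system_vf q At i)).
Hypothesis roots : forall t, qC.[t] = 0 -> forall i j, (map_poly iota (At i j)).[t] = 0.

Lemma eval_map_in_t (b : {poly K}) (p : 'rV[C]_N) :
  eval (map_mpoly iota (in_t n b)) p = (map_poly iota b).[p 0 (tvar n)].
Proof. by rewrite map_in_t eval_in_t. Qed.

Lemma system_sing (p : 'rV[C]_N) : Sing xi p <-> qC.[p 0 (tvar n)] = 0.
Proof.
split=> [/(_ (tvar n))|q0 i].
  by rewrite /system_vf (unsplitK (inl _)) eval_map_in_t.
rewrite map_system_vf /system_vf; case: (fintype.split i) => [_|j]; first by rewrite eval_in_t.
rewrite /eval rmorph_sum big1 // => k _ /=.
by rewrite mevalM -/(eval _ p) eval_in_t mxE roots // mul0r.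
Qed.

Definition regular_pts : set 'rV[C]_N := [set p | qC.[p 0 (tvar n)] != 0].

Local Notation family := (flat_family iota (frame_vf q At) (@frame_start K n) regular_pts).

Lemma map_frame : (fun k => map_mpoly iota (frame_vf q At k)) =
  frame_vf qC (map_mx (map_poly iota) At).
Proof. by apply/funext => k; rewrite map_frame_vf. Qed.

Lemma flat_lift (p : 'rV[C]_N) f :
  flat (fun k => map_mpoly iota (frame_vf q At k)) (start iota (@frame_start K n) p) (lift_poly f) <->
  flat xi p f.
Proof.
have xiE : xi = system_vf qC (map_mx (map_poly iota) At).
  by apply/funext => i; rewrite map_system_vf.
rewrite map_frame xiE frame_startE.
by split=> fl k; have := fl k; rewrite -lie_lift eval_lift row_mxKl.
Qed.

(** A polynomial in (t, y) flat at p is a g-free combination of specialised families, to which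
    [parametric_elimination] applies. At zeros of J the members of [Gs] lose their frame variables,
    so the frame may be given the value 0. *)
Lemma generic_orbit_closure (J : set (mpoly N K)) : is_ideal J -> ~ J 1 ->
  (forall a b, J (a * b) -> J a \/ J b) ->
  exists2 a, ~ J a & exists Gs : seq (mpoly M (mpoly N K)),
  forall p y : 'rV[C]_N, (forall b, J b -> ev iota p b = 0) -> ev iota p a != 0 -> regular_pts p ->
    zariski_closure (orbit xi p) y <->
    forall G, G \in Gs -> mmap (ev iota p) (fun k => row_mx y 0 0 k) G = 0.
Proof.
move=> idJ J1 Jprime.
have [|||a nJa [Gs GsI H]] := @parametric_elimination _ _ (@frame_var n) J family idJ J1 Jprime.
- exact: flat_familyD.
- exact: flat_familyZ.
- exact: flat_familyX.
exists a => //; exists Gs => p y pJ pa preg.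
rewrite closure_orbit; last by move/system_sing/eqP; apply/negP.
split=> [cl G GGs|G0 f fl].
  have [IG JG] := GsI G GGs.
  pose g := map_mpoly (ev iota p) G.
  have g0 m : wdeg (@frame_var n) m != 0%N -> g@_m = 0.
    by move=> m0; rewrite mcoeff_map_mpoly; apply: pJ; apply: JG.
  rewrite -meval_map -/g -/(eval g (row_mx y 0)) -eval_unlift; apply: cl.
  by apply/flat_lift; rewrite unliftK //; apply: IG.
have rank_const D l p1 p2 : regular_pts p1 -> regular_pts p2 -> exists l',
    (\rank (jet (fun k => map_mpoly iota (frame_vf q At k)) D l (start iota (@frame_start K n) p1)) <=
     \rank (jet (fun k => map_mpoly iota (frame_vf q At k)) D l' (start iota (@frame_start K n) p2)))%N.
  by move=> q1 q2; rewrite map_frame; apply: frame_rank_const.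
have [l [c [G [GI fE]]]] := flat_family_span rank_const preg ((flat_lift p f).2 fl).
have := H C (ev iota p) (fun k => row_mx y 0 0 k) pJ pa G0 l c G GI.
rewrite /= -fE => /(_ (@wdeg_lift _ _ f)) E.
by rewrite -(row_mxKl y (0 : 'rV_(n * n))) -eval_lift.
Qed.

Definition in_first : mpoly N K -> mpoly (N + N) K :=
  mmap (@mpolyC (N + N) K) (fun i => mpolyX K (mnm1 (lshift N i))).
HB.instance Definition _ := GRing.RMorphism.on in_first.

Lemma eval_in_first b (z : 'rV[C]_(N + N)) :
  eval (map_mpoly iota (in_first b)) z = ev iota (lsubmx z) b.
Proof.
rewrite /eval meval_map; apply: (mpoly_rmorph_ext (f := mmap iota _ \o in_first) (g := ev iota _)) => [c|i] /=.
  by rewrite /in_first /ev !mmapC.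
by rewrite /in_first /ev !mmapX !mmap1U mmapX mmap1U mxE.
Qed.

Definition in_both : mpoly M (mpoly N K) -> mpoly (N + N) K :=
  mmap in_first (fun k => if fintype.split k is inl i then mpolyX K (mnm1 (rshift N i)) else 0).
HB.instance Definition _ := GRing.RMorphism.on in_both.

Lemma eval_in_both G (z : 'rV[C]_(N + N)) : eval (map_mpoly iota (in_both G)) z =
  mmap (ev iota (lsubmx z)) (fun k => row_mx (rsubmx z) 0 0 k) G.
Proof.
rewrite /eval; apply: (mpoly_rmorph_ext (f := meval (fun i => z 0 i) \o map_mpoly iota \o in_both)
  (g := mmap (ev iota (lsubmx z)) _)) => [c|k] /=.
  by rewrite /in_both !mmapC -/(eval _ z) eval_in_first.
rewrite /in_both !mmapX !mmap1U mxE; case: (fintype.split k) => [i|e].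
  by rewrite map_mpolyX mevalXU mxE.
by rewrite !rmorph0 mxE.
Qed.

Lemma orbit_closure_constructible (J : set (mpoly N K)) : is_ideal J ->
  constructible_over iota [set z : 'rV[C]_(N + N) |
    (forall b, J b -> ev iota (lsubmx z) b = 0) /\
    zariski_closure (orbit xi (lsubmx z)) (rsubmx z)].
Proof.
move: J; apply: noetherian_induction => J idJ IH.
have [J1|J1] := pselect (J 1).
  rewrite (_ : [set z | _] = set0); first exact: constructible0.
  apply/seteqP; split=> // z [/(_ 1 J1)/eqP]; by rewrite rmorph1 oner_eq0.
have IHa a : ~ J a -> constructible_over iota [set z : 'rV[C]_(N + N) |
    ((forall b, J b -> ev iota (lsubmx z) b = 0) /\ ev iota (lsubmx z) a = 0) /\
    zariski_closure (orbit xi (lsubmx z)) (rsubmx z)].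
  move=> nJa; have idJa := adjoin_ideal a idJ.
  have := IH _ idJa (@sub_adjoin _ J a) (ex_intro2 _ _ a (mem_adjoin a idJ) nJa).
  congr (constructible_over _ _); apply/seteqP; split=> z [H cl]; split=> //.
    by split=> [b Jb|]; apply: H; [exact: sub_adjoin | exact: mem_adjoin].
  by case: H => HJ Ha b [c [d [Jc ->]]]; rewrite rmorphD rmorphM /= HJ // Ha mulr0 addr0.
(* If J is not prime, its zero set is the union of those of two strictly larger ideals. *)
have [[a [b [Jab nJa nJb]]]|prime] := pselect (exists a b, [/\ J (a * b), ~ J a & ~ J b]).
  have := constructibleU (IHa a nJa) (IHa b nJb).
  congr (constructible_over _ _); apply/seteqP; split=> z.
    by case=> -[[HJ _] cl].
  move=> [HJ cl]; have /eqP := HJ _ Jab; rewrite rmorphM mulf_eq0.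
  by case/orP=> /eqP ?; [left | right].
have {}prime a b : J (a * b) -> J a \/ J b.
  move=> Jab; have [|nJa] := pselect (J a); first by left.
  have [|nJb] := pselect (J b); first by right.
  by case: prime; exists a, b.
have [a nJa [Gs GsP]] := generic_orbit_closure idJ J1 prime.
have [s Js] := hilbert_basis idJ.
have JsP z : (forall b, J b -> ev iota (lsubmx z) b = 0) <->
    (forall f, f \in map in_first s -> eval (map_mpoly iota f) z = 0).
  split=> [H _ /mapP[b bs ->]|H b].
    by rewrite eval_in_first; apply: H; rewrite Js; apply: mem_ideal_of.
  rewrite Js => -[c ->]; rewrite rmorph_sum big1 // => k _.
  by rewrite rmorphM /= -(eval_in_first s`_k) H ?mulr0 // map_f // mem_nth.
pose diag := [seq mpolyX K (mnm1 (rshift N i)) - mpolyX K (mnm1 (lshift N i)) | i <- enum 'I_N].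
have diagP z : (forall f, f \in diag -> eval (map_mpoly iota f) z = 0) <-> rsubmx z = lsubmx z :> 'rV[C]_N.
  split=> [H|e _ /mapP[k _ ->]].
    apply/rowP => k; apply/eqP; rewrite -subr_eq0.
    have := H _ (map_f _ (mem_enum 'I_N k)).
    by rewrite rmorphB /= !map_mpolyX /eval mevalB !mevalXU !mxE => ->.
  have := congr1 (fun v : 'rV[C]_N => v 0 k) e; rewrite !mxE => ek.
  by rewrite rmorphB /= !map_mpolyX /eval mevalB !mevalXU ek subrr.
have qE (z : 'rV[C]_(N + N)) : ev iota (lsubmx z) (in_t n q) = qC.[(lsubmx z : 'rV[C]_N) 0 (tvar n)].
  by rewrite -eval_map_in_t /eval meval_map.
(* Over q = 0 the relation is the diagonal, and [[:: 1]] removes nothing; over a q <> 0 it is cut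
   out by [Gs]. Points with a = 0 belong to [IHa]. *)
have P1 := constructible_piece iota (map in_first s ++ in_first (in_t n q) :: diag) [:: 1].
have P2 := constructible_piece iota (map in_first s ++ map in_both Gs) [:: in_first (a * in_t n q)].
have := constructibleU (IHa a nJa) (constructibleU P1 P2).
congr (constructible_over _ _); apply/seteqP; split=> z.
  case=> [[[]]//|[[Z _]|[Z nZ]]].
    have Zs : forall b, J b -> ev iota (lsubmx z) b = 0.
      by apply/JsP => f fs; apply: Z; rewrite mem_cat fs.
    split=> //; apply/closure_orbit_sing.
      apply/system_sing; rewrite -qE -eval_in_first; apply: Z.
      by rewrite mem_cat inE eqxx orbT.
    by apply/diagP => f fd; apply: Z; rewrite mem_cat inE fd !orbT.
  have Zs : forall b, J b -> ev iota (lsubmx z) b = 0.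
    by apply/JsP => f fs; apply: Z; rewrite mem_cat fs.
  have : ev iota (lsubmx z) (a * in_t n q) != 0.
    apply/eqP => e; apply: nZ => f; rewrite inE => /eqP ->; by rewrite eval_in_first.
  rewrite rmorphM mulf_eq0 negb_or => /andP[an0 qn0]; split=> //.
  apply/(GsP _ _ Zs an0); first by rewrite /regular_pts /= -qE.
  by move=> G GGs; rewrite -eval_in_both; apply: Z; rewrite mem_cat map_f ?orbT.
move=> [HJ cl]; have [a0|an0] := eqVneq (ev iota (lsubmx z) a) 0; first by left.
have [q0|qn0] := eqVneq (ev iota (lsubmx z) (in_t n q)) 0; right; [left | right].
  split; last first.
    move/(_ 1); rewrite inE eqxx => /(_ isT)/eqP; by rewrite rmorph1 /eval meval1 oner_eq0.
  move=> f; rewrite mem_cat inE => /orP[|/predU1P[->|]]; first exact: (JsP z).1.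
    by rewrite eval_in_first.
  have sing : Sing xi (lsubmx z) by apply/system_sing; rewrite -qE.
  exact: (diagP z).2 ((closure_orbit_sing _ sing).1 cl) f.
split; last first.
  move/(_ (in_first (a * in_t n q))); rewrite inE eqxx => /(_ isT)/eqP.
  by rewrite eval_in_first rmorphM mulf_eq0 (negPf an0) (negPf qn0).
move=> f; rewrite mem_cat => /orP[|/mapP[G GGs ->]]; first exact: (JsP z).1.
rewrite eval_in_both; apply: (GsP _ _ HJ an0 _).1 => //.
by rewrite /regular_pts /= -qE.
Qed.
End OrbitClosure.

Theorem theorem6 (R : realType) (K : closedFieldType)
    (iota : {rmorphism K -> R[i]}) (n : nat)
    (A : 'M[{fraction {poly K}}]_n) (q : {poly K}) (At : 'M[{poly K}]_n)
    (hq : clears_poles iota A q At)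
    (hmin : forall (q' : {poly K}) (At' : 'M[{poly K}]_n),
        clears_poles iota A q' At' -> (size q <= size q')%N) :
  constructible_orbits iota (system_vf q At) [set: 'rV[R[i]]_(1 + n)].
Proof.
have roots t := @clears_poles_root _ _ _ _ _ _ _ t hq.
(* The zero ideal puts no condition on p, so its case is the whole relation. *)
have id0 : is_ideal [set (0 : mpoly (1 + n) K)].
  by split=> [//|_ _ -> ->|a _ ->]; rewrite ?addr0 ?mulr0.
have := orbit_closure_constructible roots id0; rewrite /constructible_orbits.
congr (constructible_over _ _); apply/seteqP; split=> z; first by case.
by case=> _ _ cl; split=> // _ ->; rewrite rmorph0.
Qed.
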